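(* Let $\eta$ be an $\mathbb{N}$-valued random variable. If $\mathbf{P}[\eta\ge 1]>0$, then $p_c(\mathbb{T}_d,\eta)<1$ for all $d\ge 3$.
   Context: Here $\mathbb{N}=\{0,1,2,\dots\}$, and $\mathbb{T}_d$ denotes the infinite homogeneous tree in which every vertex has degree $d$, with a fixed root $\mathbf{0}$. Frog model $\mathrm{FM}(\mathcal{G},p,\eta)$. Let $\mathcal{G}$ be an infinite connected undirected graph all of whose sites (vertices) have finite degree, with a fixed site $\mathbf{0}$ called the root; let $p\in[0,1]$ and let $\eta$ be a random variable with values in $\mathbb{N}$. Let $\{\eta(x)\}_{x}$, $\{(S^x_n(i))_{n\in\mathbb{N}}\}_{x,\,i\ge1}$, $\{\Xi^x_p(i)\}_{x,\,i\ge 1}$ be independent families of independent random variables, where $\eta(x)$ has the law of $\eta$, $(S^x_n(i))_n$ is a discrete-time simple random walk on $\mathcal{G}$ started from $x$, and $\mathbf{P}[\Xi^x_p(i)=k]=(1-p)p^{k-1}$, $k=1,2,\dots$ (for $p=1$, $\Xi^x_p(i)=\infty$, no death). Site $x$ initially contains $\eta(x)$ particles; at time $0$ all particles are sleeping except those at the root, which are active. If the particles of site $x$ are activated at time $T(x)$, the $i$-th of them ($1\le i\le\eta(x)$) is active and located at $S^x_n(i)$ at time $T(x)+n$ for $0\le n<\Xi^x_p(i)$, and then disappears. When an active particle visits a site, all sleeping particles there become active. Formally, $t(x,y)=\min_{1\le i\le\eta(x)}\min\{n<\Xi^x_p(i):S^x_n(i)=y\}$ for $x\ne y$ ($\infty$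 if there is no such $n$), and $T(x)=\inf\{t(x_0,x_1)+\dots+t(x_{m-1},x_m)\}$ over all finite sequences $\mathbf{0}=x_0,x_1,\dots,x_m=x$, with $T(\mathbf{0})=0$; $T(x)=\infty$ means that $x$ is never visited by active particles. The model survives if at every time there is at least one active particle; otherwise it dies out. The critical parameter is $p_c(\mathcal{G},\eta)=\inf\{p\in[0,1]:\mathbf{P}[\mathrm{FM}(\mathcal{G},p,\eta)\text{ survives}]>0\}$. *)

(* Defs.v *)
From mathcomp Require Import all_boot all_order all_algebra.
From mathcomp Require Import all_classical all_reals all_analysis.

Set Implicit Arguments.
Unset Strict Implicit.
Unset Printing Implicit Defensive.

Import Order.TTheory GRing.Theory Num.Theory.
Local Open Scope classical_set_scope.
Local Open Scope ring_scope.

(* Infinite connected locally finite undirected simple graphs with a root;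
   [nbrs x] lists the neighbours of [x] without repetition. *)
Record graph := Graph {
  site :> choiceType;
  nbrs : site -> seq site;
  origin : site;
  nbrs_uniq : forall x, uniq (nbrs x);
  nbrs_sym : forall x y, (y \in nbrs x) = (x \in nbrs y);
  nbrs_irr : forall x, x \notin nbrs x;
  graph_connected : forall x y, exists2 s : seq site,
    path (fun a b => b \in nbrs a) x s & last x s = y;
  graph_infinite : infinite_set [set: site] }.

(* [occ c x] is the initial number of particles at x. The particles of x are
   numbered from 0, so that they are those with index i < occ c x.
   [traj c x i] is the trajectory of the i-th one and [life c x i] its
   lifetime, [None] standing for an infinite lifetime. *)
Record configuration (G : graph) := Configuration {
  occ : G -> nat;
  traj : G -> nat -> nat -> G;
  life : G -> nat -> option nat }.

Definition alive (n : nat) (l : option nat) : bool :=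
  if l is Some k then (n < k)%N else true.

Section dynamics.
Context {R : realType} {G : graph}.
Variable c : configuration G.

Definition passage_time (x y : G) : \bar R :=
  ereal_inf [set (n%:R)%:E | n in [set n : nat | exists i : nat,
    [/\ (i < occ c x)%N, alive n (life c x i) & traj c x i n = y]]].

Fixpoint chain_time (x : G) (s : seq G) : \bar R :=
  if s is y :: s' then (passage_time x y + chain_time y s')%E else 0%E.

(* [passage_time x y] is only meant for x != y, whence the condition on
   consecutive sites; the chain [:: ] gives activation time 0 to the root. *)
Definition activation_time (x : G) : \bar R :=
  ereal_inf [set chain_time (origin G) s | s in [set s : seq G |
    path (fun a b => a != b) (origin G) s /\ last (origin G) s = x]].

Definition active_at (n : nat) (x : G) (i : nat) : Prop :=
  (i < occ c x)%N /\ exists2 k : nat,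
    alive k (life c x i) & (activation_time x + (k%:R)%:E)%E = (n%:R)%:E.

Definition survives : Prop := forall n : nat, exists x i, active_at n x i.

End dynamics.
Arguments survives R {G} c.

Definition mutually_independent {d} {Omega : measurableType d} {R : realType}
    (P : probability Omega R) {I : eqType} (F : I -> set (set Omega)) : Prop :=
  forall (J : seq I) (A : I -> set Omega), uniq J ->
    (forall j, j \in J -> F j (A j)) ->
    P (\big[setI/setT]_(j <- J) A j) = (\prod_(j <- J) P (A j))%E.

(* Probability that the first steps of a simple random walk from x follow s. *)
Fixpoint srw_prob (R : realType) (G : graph) (x : G) (s : seq G) : R :=
  if s is y :: s' then
    (if y \in nbrs x then (size (nbrs x))%:R^-1 else 0) * srw_prob R y s'
  else 1.

(* Indices of the independent sources of randomness: the number of particles of each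
   site, and the trajectory and the lifetime of each particle. *)
Definition source (G : graph) : choiceType := (G + (G * nat + G * nat))%type.

Section model.
Context {d} {Omega : measurableType d} {R : realType} {G : graph}.
Variables (P : probability Omega R) (C : Omega -> configuration G).

Definition source_events (k : source G) : set (set Omega) :=
  match k with
  | inl x => [set [set w | occ (C w) x = n] | n in [set: nat]]
  | inr (inl (x, i)) => [set A | exists (n : nat) (y : G),
                           A = [set w | traj (C w) x i n = y]]
  | inr (inr (x, i)) => [set [set w | life (C w) x i = l] |
                           l in [set: option nat]]
  end.

Record is_frog_model (p : R) (mu : probability nat R) : Prop := {
  frog_measurable : forall k, source_events k `<=` measurable;
  frog_count : forall x n, P [set w | occ (C w) x = n] = mu [set n];
  frog_traj : forall x i s,
    P [set w | mkseq (traj (C w) x i) (size s).+1 = x :: s] =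
    (srw_prob R x s)%:E;
  frog_life : forall x i k,
    P [set w | life (C w) x i = Some k.+1] = ((1 - p) * p ^+ k)%:E;
  frog_immortal : p = 1 -> forall x i, P [set w | life (C w) x i = None] = 1%E;
  frog_independent :
    mutually_independent P (fun k => <<s source_events k >>) }.

End model.

(* The law of the random configuration is determined by G, p and mu, so it does
   not matter on which probability space the model is realised. *)
Definition survives_with_positive_probability (R : realType) (G : graph)
    (p : R) (mu : probability nat R) : Prop :=
  exists (d : measure_display) (Omega : measurableType d)
    (P : probability Omega R) (C : Omega -> configuration G),
    is_frog_model P C p mu /\ (0 < P [set w | survives R (C w)])%E.

(* Infimum in \bar R, so that it is +oo rather than 0 for an empty set. *)
Definition critical_parameter (R : realType) (G : graph)
    (mu : probability nat R) : \bar R :=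
  ereal_inf [set p%:E | p in [set p : R |
    0 <= p <= 1 /\ survives_with_positive_probability G p mu]].

Section homogeneous_tree.
Variable d : nat.

(* Sites are the words on d letters with no two equal consecutive letters. The
   root is the empty word and the parent of a :: s is s: the root has d
   children, any other site has d - 1 children and a parent. *)
Definition word := {s : seq 'I_d | sorted (fun a b => a != b) s}.

Definition word_nbrs (u : word) : seq word :=
  pmap insub ((if val u is a :: s then [:: s] else [::])
              ++ map (fun a => a :: val u) (enum 'I_d)).

Definition empty_word : word := exist _ [::] isT.

Lemma mem_word_nbrs (u v : word) : (v \in word_nbrs u) =
  (ohead (val u) && (val v == behead (val u))) ||
  (ohead (val v) && (val u == behead (val v))).
Proof.
rewrite mem_pmap_sub mem_cat; congr orb.
  by case: (val u) => [|a s]; rewrite ?inE //= inE.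
apply/mapP/andP => [[a _ ->]|] //=.
case: (val v) => [|a s] /= [] // _ /eqP ->; exists a; rewrite ?mem_enum //.
Qed.

Lemma word_nbrs_uniq u : uniq (word_nbrs u).
Proof.
apply: (pmap_uniq (@insubK _ _ _)).
rewrite cat_uniq map_inj_uniq ?enum_uniq; last by move=> a b [].
rewrite andbT; case: (val u) => [|a s] //=; first by rewrite has_pred0.
rewrite -all_predC; apply/allP => x /mapP[b _ ->] /=; rewrite inE.
by apply/negP => /eqP /(congr1 size) /= /eqP; elim: (size s).
Qed.

Lemma word_nbrs_sym u v : (v \in word_nbrs u) = (u \in word_nbrs v).
Proof. by rewrite !mem_word_nbrs orbC. Qed.

Lemma word_nbrs_size u v : v \in word_nbrs u ->
  size (val u) = (size (val v)).+1 \/ size (val v) = (size (val u)).+1.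
Proof.
rewrite mem_word_nbrs => /orP[] /andP[].
  by case: (val u) => //= a s _ /eqP->; left.
by case: (val v) => //= a s _ /eqP->; right.
Qed.

Lemma word_nbrs_irr u : u \notin word_nbrs u.
Proof. by apply/negP => /word_nbrs_size [] /eqP; elim: (size _). Qed.

Lemma word_connected_empty (u : word) : exists2 s : seq word,
  path (fun a b => b \in word_nbrs a) u s & last u s = empty_word.
Proof.
case: u => s; elim: s => [|a s IH] us.
  by exists [::] => //; apply/val_inj.
have us' : sorted (fun a b : 'I_d => a != b) s by exact: (path_sorted us).
have [t pt lt] := IH us'; exists (exist _ s us' :: t) => //=.
by rewrite pt mem_word_nbrs /= eqxx.
Qed.

Lemma word_connected (u v : word) : exists2 s : seq word,
  path (fun a b => b \in word_nbrs a) u s & last u s = v.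
Proof.
have [s ps ls] := word_connected_empty u.
have [t pt lt] := word_connected_empty v.
exists (s ++ rev (belast v t)).
  rewrite cat_path ps ls -lt rev_path.
  by rewrite (@eq_path _ _ (fun a b => b \in word_nbrs a)) // => a b; rewrite word_nbrs_sym.
rewrite last_cat ls; case: t lt {pt} => [/= <- //|a t _] /=.
by rewrite rev_cons last_rcons.
Qed.

Lemma word_infinite : (1 < d)%N -> infinite_set [set: word].
Proof.
move=> d1 fin.
pose a : 'I_d := Ordinal (ltnW d1); pose b : 'I_d := Ordinal d1.
pose alt := fix alt (x y : 'I_d) n := if n is m.+1 then x :: alt y x m else [::].
have szalt n x y : size (alt x y n) = n.
  by elim: n x y => //= n IH x y; rewrite IH.
have salt n x y : x != y -> sorted (fun a b : 'I_d => a != b) (alt x y n).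
  elim: n x y => // -[|n] // IH x y xy.
  by rewrite /= xy; apply: (IH y x); rewrite eq_sym.
apply: infinite_nat; apply: sub_finite_set (finite_image (fun u : word => size (val u)) fin).
move=> n _; exists (exist _ (alt a b n) (salt n a b isT)) => //=.
Qed.

Definition Td (d_ge2 : (1 < d)%N) : graph :=
  Graph empty_word word_nbrs_uniq word_nbrs_sym word_nbrs_irr word_connected
    (word_infinite d_ge2).

Lemma Td_degree (d_ge2 : (1 < d)%N) (x : Td d_ge2) : size (nbrs x) = d.
Proof.
rewrite /= size_pmap_sub count_cat count_map; case: x => -[|a s] us /=.
  rewrite (@eq_count _ _ predT) // count_predT.
  by rewrite -cardE card_ord.
rewrite (path_sorted us) addn0 (@eq_count _ _ (predC1 a)); last first.
  move=> b /=; have us' : path (fun c e : 'I_d => c != e) a s by exact: us.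
  by rewrite us' andbT.
rewrite -[RHS](card_ord d) cardE -(count_predC (pred1 a)).
by rewrite count_uniq_mem ?enum_uniq // mem_enum.
Qed.

Lemma Td_acyclic (d_ge2 : (1 < d)%N) (s : seq (Td d_ge2)) :
  uniq s -> cycle (fun a b => b \in nbrs a) s -> (size s <= 2)%N.
Proof.
have parent (u v : word) : v \in word_nbrs u ->
    (size (val v) <= size (val u))%N -> val v = behead (val u).
  rewrite mem_word_nbrs => /orP[/andP[_ /eqP //]|/andP[]].
  by case: (val v) => //= a t _ /eqP ->; rewrite ltnn.
have max_word (a : word) (t : seq word) : exists2 u : word, u \in a :: t &
    forall v : word, v \in a :: t -> (size (val v) <= size (val u))%N.
  elim: t a => [|b t IH] a; first by exists a => [|v]; rewrite inE // => /eqP ->.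
  have [u ut um] := IH b.
  have [le|lt] := leqP (size (val a)) (size (val u)).
    exists u => [|v]; first by rewrite inE ut orbT.
    by rewrite inE => /orP[/eqP -> //|]; exact: um.
  exists a => [|v]; first exact: mem_head.
  rewrite inE => /orP[/eqP -> //|/um vu]; exact: leq_trans vu (ltnW lt).
case: s => // u0 s0; set s := u0 :: s0 => us cs.
have [u uins umax] := max_word u0 s0.
have [i t rs] := rot_to uins.
have umax' (v : word) : v \in t -> (size (val v) <= size (val u))%N.
  by move=> vt; apply: umax; rewrite -(mem_rot i) rs inE vt orbT.
rewrite -(size_rot i); rewrite -(rot_uniq i) in us; rewrite -(rot_cycle i) in cs.
move: us cs; rewrite rs {rs}; case: t umax' => // b t umax'.
case/lastP: t umax' => [|t c] // umax' us.
rewrite /cycle rcons_path /= last_rcons => /andP[/andP[ub _] cu].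
have cin : c \in b :: rcons t c by rewrite inE mem_rcons mem_head orbT.
rewrite word_nbrs_sym in cu.
have bc : b = c.
  apply: val_inj; rewrite (parent u b) ?umax' ?mem_head //.
  by rewrite (parent u c) ?umax'.
by move: us; rewrite bc /= mem_rcons mem_head andbF.
Qed.

End homogeneous_tree.

(* Main.v *)
Require Import Defs.
From HB Require Import structures.
From mathcomp Require Import all_boot all_order all_algebra.
From mathcomp Require Import all_classical all_reals all_analysis.
From mathcomp Require Import measurable_realfun ring lra.

Import Order.TTheory GRing.Theory Num.Theory.
Import numFieldNormedType.Exports.
Local Open Scope classical_set_scope.
Local Open Scope ring_scope.

(* For p < 1 close to 1 the process contains a supercritical branching process
   of particles moving away from the root. Follow the first particle of a site
   with an initial direction away from the root. The level process of the walk
   is a biased walk, so with a probability bounded below uniformly in L it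
   descends L + 1 levels in that direction, and it does so before dying if p is
   close to 1. On the geodesic to the site reached lie L visited sites, each of
   which is occupied with probability q = P(eta >= 1) > 0; since d >= 3, each
   of them has a child off the geodesic, and the particles of these sites that
   start towards those children explore disjoint subtrees. The mean offspring
   number is thus of order q L, which is large for L large. If e is the
   probability of lasting n generations, that of lasting n + 1 is at least
   c q (1 - (1 - e)^L), and e = 1/L is preserved by this recursion. Finally a
   particle moves by one level per unit of time, so reaching all levels forces
   survival. *)

Set Implicit Arguments.
Unset Strict Implicit.
Unset Printing Implicit Defensive.

(** * Independence of blocks *)

(** Survival with positive probability asks for a realisation of the model, so one is built, all its
    variables being read off a single uniform point of the unit interval. Independence of siblings
    does not require the walks to stay in disjoint regions: randomness is attached to the site where
    a particle sleeps, wherever it walks later. It is enough that the event about [u] consults only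
    the sources in the subtree of [u] and at its parent. No limit theorem on branching processes
    enters, since each generation records only that some offspring succeeds. The constants are
    chosen in the order [L], from [q] and [d], then the number [M] of steps, from [L], then [p],
    from [M]. There is no circularity, because the hitting bound [1 / (4 * d)] involves neither [L]
    nor [M]. *)

Lemma bigsetIP (T : Type) (I : eqType) (s : seq I) (A : I -> set T) (x : T) :
  (\big[setI/setT]_(i <- s) A i) x <-> (forall i, i \in s -> A i x).
Proof.
elim: s => [|a s IH]; first by rewrite big_nil.
rewrite big_cons; split => [[Aa /IH As] i|H].
  by rewrite inE => /orP[/eqP -> //|]; exact: As.
split; first by apply: H; rewrite mem_head.
by apply/IH => i si; apply: H; rewrite inE si orbT.
Qed.

Lemma bigsetUP (T : Type) (I : eqType) (s : seq I) (A : I -> set T) (x : T) :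
  (\big[setU/set0]_(i <- s) A i) x <-> (exists2 i, i \in s & A i x).
Proof.
elim: s => [|a s IH]; first by rewrite big_nil; split=> // -[].
rewrite big_cons; split => [[Aa|/IH [i si Ai]]|[i]].
- by exists a; rewrite ?mem_head.
- by exists i; rewrite // inE si orbT.
- by rewrite inE => /orP[/eqP -> Aa|si Ai]; [left|right; apply/IH; exists i].
Qed.

Section independence.
Context {d} {T : measurableType d} {R : realType} (P : probability T R).

Lemma sub_measurable_sigma (F : set (set T)) :
  F `<=` measurable -> <<s F >> `<=` measurable.
Proof. by move=> FM; apply: smallest_sub => //; exact: sigma_algebra_measurable. Qed.

(** Dynkin's argument: with [X] fixed, the events satisfying the product formula form a Dynkin
    system, which contains the sigma-algebra generated by the pi-system [F]. *)
Lemma independent_sigma (F : set (set T)) (X : set T) :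
  setI_closed F -> F `<=` measurable -> measurable X ->
  (forall A, F A -> P (A `&` X) = (P A * P X)%E) ->
  forall A, <<s F >> A -> P (A `&` X) = (P A * P X)%E.
Proof.
move=> FI FM mX FX A; rewrite -setI_closed_g_dynkin_g_sigma_algebra // => sA.
suff: <<d F >> `<=` [set A | measurable A /\ P (A `&` X) = (P A * P X)%E].
  by move=> /(_ _ sA)[].
apply: smallest_sub; last by move=> B FB; split; [exact: FM|exact: FX].
split.
- by split => //; rewrite setTI probability_setT mul1e.
- move=> B [mB PB]; split; first exact: measurableC.
  have -> : P (~` B `&` X) = (P X - P (B `&` X))%E.
    by rewrite setIC -setDE measureD ?ltey_eq ?fin_num_measure // (setIC B).
  rewrite PB probability_setC // -(fineK (fin_num_measure P B mB)).
  rewrite -(fineK (fin_num_measure P X mX)) -EFinM -EFinB.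
  by rewrite -EFinB -EFinM mulrBl mul1r.
- move=> B tB mB; split; first by apply: bigcupT_measurable => n; have [] := mB n.
  have mB1 n : measurable (B n) by have [] := mB n.
  rewrite setI_bigcupl measure_bigcup //; last 2 first.
  + by move=> n _; exact: measurableI.
  + exact: trivIset_setIr.
  rewrite (eq_eseriesr (g := fun n => (P (B n) * P X)%E)); last first.
    by move=> n _; have [] := mB n.
  rewrite measure_bigcup // muleC -(fineK (fin_num_measure P X mX)).
  rewrite -nneseriesZl => [|n _]; last exact: measure_ge0.
  by apply: eq_eseriesr => n _; rewrite muleC.
Qed.

(** Finite intersections of events from the sources of a block form a pi-system generating the
    sigma-algebra of the block. Blocks are upgraded from pi-system to sigma-algebra one at a
    time. *)
Lemma mutually_independent_block (I K : eqType) (F : I -> set (set T))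
    (D : K -> set I) :
  (forall i, F i `<=` measurable) -> (forall i, setI_closed (F i)) ->
  trivIset setT D -> mutually_independent P F ->
  mutually_independent P (fun k => <<s \bigcup_(i in D k) F i >>).
Proof.
move=> FM FI tD indF.
pose B k : set (set T) := [set X | exists (s : seq I) (A : I -> set T),
  [/\ uniq s, forall i, i \in s -> D k i /\ F i (A i) &
      X = \big[setI/setT]_(i <- s) A i]].
have BM k : B k `<=` measurable.
  move=> _ [s [A [_ As ->]]]; rewrite big_seq; apply: bigsetI_measurable => i.
  by move=> /As [_]; exact: FM.
have FB k : \bigcup_(i in D k) F i `<=` B k.
  move=> X [i Di FX]; exists [:: i], (fun=> X); split => // [j|].
    by rewrite inE => /eqP ->.
  by rewrite big_seq1.
have BI k : setI_closed (B k).
  move=> _ _ [s [A [us As ->]]] [s' [A' [us' As' ->]]].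
  (* On indices common to both families the two events are intersected, which is where closure of
     [F i] under intersection is used. *)
  exists (undup (s ++ s')), (fun i => if i \in s then
    if i \in s' then A i `&` A' i else A i else A' i); split.
  - exact: undup_uniq.
  - move=> i; rewrite mem_undup mem_cat.
    case: (boolP (i \in s)) => [/As [Di Fi]|_ /=].
      by case: (boolP (i \in s')) => // /As' [_ Fi'] _; split => //; exact: FI.
    by move/As'.
  - apply/seteqP; split => w.
      move=> [/bigsetIP H /bigsetIP H']; apply/bigsetIP => i.
      rewrite mem_undup mem_cat.
      case: (boolP (i \in s)) => [si _|_ /= si']; last exact: H'.
      case: (boolP (i \in s')) => [si'|_]; last exact: H.
      by split; [exact: H|exact: H'].
    move=> /bigsetIP H; split; apply/bigsetIP => i si.
      have := H i; rewrite mem_undup mem_cat si => /(_ isT).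
      by case: ifP => // _ [].
    have := H i; rewrite mem_undup mem_cat si orbT => /(_ isT).
    by case: ifP => // _ [].
have sM k : <<s \bigcup_(i in D k) F i >> `<=` measurable.
  by apply: sub_measurable_sigma => X /FB /BM.
(* The blocks in [l] are already upgraded, while [s] lists single events lying outside these blocks.
   Upgrading [k] fixes all the rest as the event [X] of the Dynkin argument; the members of the
   pi-system of [k] are absorbed into [s]. *)
have key (l : seq K) (s : seq I) (X : K -> set T) (A : I -> set T) :
    uniq l -> (forall k, k \in l -> <<s \bigcup_(i in D k) F i >> (X k)) ->
    uniq s -> (forall i, i \in s -> F i (A i)) ->
    (forall i k, i \in s -> k \in l -> ~ D k i) ->
    P (\big[setI/setT]_(k <- l) X k `&` \big[setI/setT]_(i <- s) A i) =
    (\prod_(k <- l) P (X k) * \prod_(i <- s) P (A i))%E.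
  elim: l s A => [|k l IH] s A.
    by move=> _ _ us FA _; rewrite !big_nil setTI mul1e; exact: indF.
  move=> /= /andP[kl ul] Xl us FA sl.
  have Xl' k' : k' \in l -> <<s \bigcup_(i in D k') F i >> (X k').
    by move=> k'l; apply: Xl; rewrite inE k'l orbT.
  have sl' i k' : i \in s -> k' \in l -> ~ D k' i.
    by move=> si k'l; apply: sl => //; rewrite inE k'l orbT.
  rewrite !big_cons -setIA -muleA -(IH s A) //.
  apply: (@independent_sigma (B k)) => //.
  - apply: measurableI; rewrite big_seq; apply: bigsetI_measurable => i.
      by move=> /Xl'; exact: sM.
    by move=> /FA; exact: FM.
  - move=> _ [s' [A' [us' As' ->]]].
    have ss' i : i \in s -> i \notin s'.
      move=> si; apply/negP => /As' [Di _].
      by apply: (sl i k si) => //; rewrite mem_head.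
    have As'' i : i \in s' -> F i (A' i) by move=> /As' [].
    pose A2 i := if i \in s' then A' i else A i.
    have E1 : \big[setI/setT]_(i <- s') A' i = \big[setI/setT]_(i <- s') A2 i.
      by apply: eq_big_seq => i; rewrite /A2 => ->.
    have E2 : \big[setI/setT]_(i <- s) A i = \big[setI/setT]_(i <- s) A2 i.
      by apply: eq_big_seq => i /ss' /negbTE; rewrite /A2 => ->.
    have E : \big[setI/setT]_(i <- s') A' i `&` (\big[setI/setT]_(j <- l) X j `&`
        \big[setI/setT]_(i <- s) A i) = \big[setI/setT]_(j <- l) X j `&`
        \big[setI/setT]_(i <- s' ++ s) A2 i.
      by rewrite E1 E2 big_cat /= setICA.
    rewrite E (IH (s' ++ s) A2) //.
    + rewrite (IH s A) // big_cat /= muleCA; congr (_ * (_ * _))%E.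
        rewrite (indF s' A') //.
        by apply: eq_big_seq => i; rewrite /A2 => ->.
      by apply: eq_big_seq => i /ss' /negbTE; rewrite /A2 => ->.
    + rewrite cat_uniq us us' andbT; apply/hasPn => i /ss'; exact.
    + move=> i; rewrite mem_cat /A2; case: (boolP (i \in s')) => /= [|_].
        by move=> is' _; exact: As''.
      exact: FA.
    + move=> i j; rewrite mem_cat => /orP[|] si jl; last exact: sl'.
      move=> Dj; have [Dk _] := As' _ si.
      have jk : j = k by apply: (tD j k) => //; exists i.
      by move: kl; rewrite -jk jl.
  - have := Xl k; rewrite mem_head => /(_ isT).
    by apply: sub_smallest2r => //; exact: FB.
move=> l X ul Xl; have := key l [::] X (fun=> setT) ul Xl.
by rewrite !big_nil setIT mule1; apply.
Qed.

Lemma mutually_independent_sub (I : eqType) (F F' : I -> set (set T)) :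
  (forall i, F i `<=` F' i) -> mutually_independent P F' ->
  mutually_independent P F.
Proof. by move=> FF' ind J A uJ JA; apply: ind => // j /JA /FF'. Qed.

End independence.

(** * A sequence of independent discrete variables on the unit interval *)

Section unit_interval.
Context {R : realType}.
Local Notation lambda := (@lebesgue_measure R).

Lemma measurable_affine (c m : R) :
  measurable_fun [set: measurableTypeR R]
    (fun u : measurableTypeR R => (u - c) / m : measurableTypeR R).
Proof. by apply: measurable_funM => //; exact: measurable_funB. Qed.

(** The image measure divided by [m] agrees with Lebesgue measure on half-open intervals, hence
    everywhere by uniqueness. *)
Lemma lebesgue_measure_affine (c m : R) (B : set (measurableTypeR R)) :
  0 < m -> measurable B ->
  lambda ((fun u => (u - c) / m) @^-1` B) = (m%:E * lambda B)%E.
Proof.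
move=> m0 mB.
have im0 : 0 <= m^-1 by rewrite invr_ge0 ltW.
pose mu := mscale (NngNum im0) (pushforward lambda
  (fun u : measurableTypeR R => (u - c) / m : measurableTypeR R)).
have -> : lambda B = mu (measurable_affine c m) B.
  apply: lebesgue_measure_unique => // _ [[a b]] _ <-.
  have E : (fun u : R => (u - c) / m) @^-1` `]a, b] = `]a * m + c, b * m + c]%classic.
    apply/seteqP; split => x /=; rewrite !in_itv /=;
      by rewrite ltr_pdivlMr // ler_pdivrMr // ltrBrDr lerBlDr.
  transitivity ((m^-1)%:E * lambda ((fun u : R => (u - c) / m)%R @^-1` `]a, b]))%E; last by [].
  rewrite E !lebesgue_measure_itv /= !lte_fin ltrD2r ltr_pM2r //.
  case: ifP => _; last by rewrite mule0.
  rewrite -!EFinB -EFinM; congr EFin; field; exact: lt0r_neq0.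
by rewrite /mu /mscale /pushforward /= muleA -EFinM divff ?mul1e // lt0r_neq0.
Qed.

Definition unit_lebesgue : set (measurableTypeR R) -> \bar R :=
  mrestr lambda (measurable_itv `[0, 1[).

HB.instance Definition _ := Measure.on unit_lebesgue.

Lemma unit_lebesgue_setT : unit_lebesgue setT = 1%E.
Proof.
by rewrite /unit_lebesgue /mrestr setTI lebesgue_measure_itv /= lte_fin ltr01 oppr0 adde0.
Qed.

HB.instance Definition _ :=
  Measure_isProbability.Build _ _ _ unit_lebesgue unit_lebesgue_setT.

End unit_interval.

Section splitting.
Context {R : realType}.
Implicit Types (f : nat -> R) (S : set nat).
Local Notation lambda := (@unit_lebesgue R).
Local Notation Omega := (measurableTypeR R).

Definition is_pmf f := (forall n, 0 <= f n) /\ series f @ \oo --> (1 : R).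

Definition pmf_law f S : \bar R := (\sum_(n <oo | n \in S) (f n)%:E)%E.

Lemma pmf_law_setT f : is_pmf f -> pmf_law f setT = 1%E.
Proof.
move=> [f0 f1]; rewrite /pmf_law.
rewrite (eq_eseriesl (Q := xpredT)); last by move=> n; rewrite in_setT.
have -> : (fun n : nat => \sum_(0 <= k < n) (f k)%:E)%E = EFin \o series f.
  by apply/funext => n /=; rewrite sumEFin.
rewrite EFin_lim; last by apply/cvg_ex; exists 1.
by congr EFin; exact: cvg_lim.
Qed.

(** Inverse distribution function: the partial sums of [f] cut the unit interval into pieces of
    length [f n], and the index of the piece containing [u] is returned. The default [0] serves
    points above all partial sums. *)
Definition select f (u : Omega) : nat :=
  if pselect (exists n, u < series f n.+1) is left e then ex_minn e else 0%N.

(** Position of [u] inside its piece, rescaled to the unit interval. It is again uniform and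
    independent of the index of the piece, so the extraction can be iterated forever. *)
Definition refine f (u : Omega) : Omega :=
  (u - series f (select f u)) / f (select f u).

Lemma series_le f m n : is_pmf f -> (m <= n)%N -> series f m <= series f n.
Proof.
move=> [f0 _]; exact: (@nondecreasing_series _ f xpredT 0%N (fun n _ _ => f0 n)).
Qed.

Lemma selectP f n (u : Omega) : is_pmf f -> 0 <= u < 1 ->
  select f u = n <-> series f n <= u < series f n.+1.
Proof.
move=> pf /andP[u0 u1]; have [f0 f1] := pf.
have ex : exists n, u < series f n.+1.
  have [N _ HN] := cvgr_gt _ f1 _ u1.
  exists N; apply: (lt_le_trans (HN N _)) => //=.
  exact: series_le.
have sel : series f (select f u) <= u < series f (select f u).+1.
  rewrite /select; case: pselect => // e; case: ex_minnP => k uk kmin.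
  rewrite uk andbT; case: k uk kmin => [|k] uk kmin.
    by rewrite /series /= big_geq.
  by rewrite leNgt; apply/negP => /kmin; rewrite ltnn.
split => [<- //|/andP[nu un]].
apply/eqP; case/andP: sel => su us.
rewrite eqn_leq; apply/andP; split; rewrite leqNgt; apply/negP => lt.
  by have := lt_le_trans un (le_trans (series_le pf lt) su); rewrite ltxx.
by have := lt_le_trans us (le_trans (series_le pf lt) nu); rewrite ltxx.
Qed.

Lemma measurable_select f n : measurable [set u | select f u = n].
Proof.
pose E k : set Omega := [set u | u < series f k.+1].
have mE k : measurable (E k).
  rewrite (_ : E k = `]-oo, series f k.+1[%classic); first exact: measurable_itv.
  by apply/seteqP; split => u; rewrite /E /= in_itv.
have mX : measurable (E n `&` \bigcap_(k in [set k | (k < n)%N]) ~` E k).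
  apply: measurableI => //; apply: bigcap_measurableType => k _.
  exact: measurableC.
have mY : measurable (\bigcap_k ~` E k).
  by apply: bigcap_measurableType => k _; exact: measurableC.
(* The extra term for [n = 0] collects the points above all partial sums, where [select] takes its
   default value. *)
rewrite (_ : [set u | _] = E n `&` \bigcap_(k in [set k | (k < n)%N]) ~` E k `|`
    (if n == 0%N then \bigcap_k ~` E k else set0)).
  by apply: measurableU => //; case: ifP => // _; exact: measurable0.
apply/seteqP; split => u /=; rewrite /select; case: pselect => [e|ne].
- case: ex_minnP => k uk kmin kn; left; split; first by rewrite -kn.
  by move=> j /= jn /kmin; rewrite kn leqNgt jn.
- by move=> <-; right => k _ uk; apply: ne; exists k.
- move=> [[un kn]|]; last first.
    case: ifP => // _ H; case: e => k uk.
    by exfalso; apply: (H k I).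
  case: ex_minnP => k uk kmin; apply/eqP; rewrite eqn_leq kmin //=.
  by rewrite leqNgt; apply/negP => /kn.
- move=> [[un _]|]; first by case: ne; exists n.
  by case: eqP => [->|].
Qed.

Lemma measurable_select_in f S : measurable [set u | S (select f u)].
Proof.
rewrite (_ : [set u | _] = \bigcup_(n in S) [set u | select f u = n]).
  by apply: bigcup_measurable => n _; exact: measurable_select.
apply/seteqP; split => u /= => [H|[n Sn] /= -> //].
by exists (select f u).
Qed.

Lemma measurable_refine f : measurable_fun [set: Omega] (refine f).
Proof.
move=> _ B mB; rewrite setTI.
rewrite (_ : _ @^-1` _ = \bigcup_n ([set u | select f u = n] `&`
    (fun u : Omega => (u - series f n) / f n : Omega) @^-1` B)).
  apply: bigcupT_measurable => n; apply: measurableI.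
    exact: measurable_select.
  by rewrite -[X in measurable X]setTI; exact: measurable_affine.
apply/seteqP; split => u /=.
  by move=> Bu; exists (select f u).
by move=> [n _ [<-]].
Qed.

(** On the piece of index [n] the map [refine f] is affine of slope [1 / f n] onto the unit
    interval, so measures are multiplied by [f n]. If [f n = 0] the piece is empty inside the unit
    interval. *)
Lemma unit_lebesgue_select_eq f n (B : set Omega) : is_pmf f -> measurable B ->
  lambda ([set u | select f u = n] `&` refine f @^-1` B) =
  ((f n)%:E * lambda B)%E.
Proof.
move=> pf mB; have [f0 _] := pf.
rewrite /lambda /mrestr.
have := f0 n; rewrite le_eqVlt => /orP[/eqP fn|fn].
  rewrite -fn mul0e (_ : _ `&` _ = set0) ?measure0 //.
  apply/seteqP; split => u //= [[su _]]; rewrite in_itv /= => u01.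
  move: su; rewrite selectP // seriesSr -fn addr0 => /andP[a b].
  by have := le_lt_trans a b; rewrite ltxx.
rewrite -(lebesgue_measure_affine (series f n)) //; last first.
  by apply: measurableI => //; exact: measurable_itv.
have s1 k : series f k <= 1.
  have [_ f1] := pf; rewrite -(cvg_lim (@Rhausdorff R) f1).
  apply: nondecreasing_cvgn_le; last by apply/cvg_ex; exists 1.
  by move=> *; exact: series_le.
have s0 k : 0 <= series f k by rewrite sumr_ge0.
have E (u : R) : (0 <= (u - series f n) / f n < 1) =
    (series f n <= u < series f n.+1).
  by rewrite ler_pdivlMr // ltr_pdivrMr // mul0r mul1r subr_ge0 ltrBlDl seriesSr.
congr lebesgue_measure; apply/seteqP; split => u /=; rewrite !in_itv /= E.
  move=> [[sn Bu] u01]; split; first by move: Bu; rewrite /refine sn.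
  by apply/selectP.
move=> [Bu un]; have u01 : 0 <= u < 1.
  move: un => /andP[nu un]; rewrite (le_trans (s0 n) nu) /=.
  exact: lt_le_trans un (s1 _).
split => //; have sn : select f u = n by apply/selectP.
by split => //; rewrite /refine sn.
Qed.

Lemma unit_lebesgue_select f S (B : set Omega) : is_pmf f -> measurable B ->
  lambda ([set u | S (select f u)] `&` refine f @^-1` B) =
  (pmf_law f S * lambda B)%E.
Proof.
move=> pf mB; have [f0 _] := pf.
have mr : measurable (refine f @^-1` B).
  by rewrite -[X in measurable X]setTI; exact: measurable_refine.
rewrite (_ : _ `&` _ = \bigcup_(n in S) ([set u | select f u = n] `&`
    refine f @^-1` B)); last first.
  apply/seteqP; split => u /=; first by move=> [Su Bu]; exists (select f u).
  by move=> [n Sn [sn Bu]]; rewrite sn.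
rewrite measure_bigcup; last 2 first.
- by move=> n _; apply: measurableI => //; exact: measurable_select.
- by move=> i j _ _ [u [[/= <- _] [/= <- _]]].
rewrite (eq_eseriesr (g := fun n => (lambda B * (f n)%:E)%E)); last first.
  by move=> n _; rewrite muleC -unit_lebesgue_select_eq.
rewrite -(fineK (fin_num_measure (unit_lebesgue : probability _ _) B mB)).
by rewrite nneseriesZl 1?muleC // => n _; rewrite lee_fin.
Qed.

Variable F : nat -> nat -> R.
Hypothesis pF : forall k, is_pmf (F k).

Fixpoint refined (k : nat) (u : Omega) : Omega :=
  if k is k'.+1 then refine (F k') (refined k' u) else u.

Definition draw (k : nat) (u : Omega) : nat := select (F k) (refined k u).

Lemma measurable_refined k : measurable_fun [set: Omega] (refined k).
Proof.
elim: k => [|k IH]; first exact: measurable_id.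
exact: measurableT_comp (measurable_refine (F k)) IH.
Qed.

Lemma measurable_draw k S : measurable (draw k @^-1` S).
Proof.
rewrite -[X in measurable X]setTI.
exact: (measurable_refined k measurableT (measurable_select_in (F k) S)).
Qed.

(** The event [B] about what remains of the uniform variable carries the induction: the last draw
    and the remainder after it are together an event about the previous remainder. *)
Lemma draw_prefix m (S : nat -> set nat) (B : set Omega) : measurable B ->
  lambda ([set u | forall k, (k < m)%N -> S k (draw k u)] `&` refined m @^-1` B) =
  (\prod_(0 <= k < m) pmf_law (F k) (S k) * lambda B)%E.
Proof.
elim: m B => [|m IH] B mB.
  rewrite big_geq // mul1e; congr unit_lebesgue.
  by apply/seteqP; split => u /=; [case|split].
have mB' : measurable ([set u | S m (select (F m) u)] `&` refine (F m) @^-1` B).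
  apply: measurableI; first exact: measurable_select_in.
  by rewrite -[X in measurable X]setTI; exact: measurable_refine.
rewrite big_nat_recr //= -muleA -unit_lebesgue_select // -IH //.
congr unit_lebesgue; apply/seteqP; split => u /=.
  move=> [H Bu]; split; first by move=> k km; apply: H; exact: ltnW.
  by split => //; exact: H.
move=> [H [Sm Bu]]; split => // k; rewrite ltnS leq_eqVlt => /orP[/eqP -> //|].
exact: H.
Qed.

Lemma draw_independent (J : seq nat) (S : nat -> set nat) : uniq J ->
  lambda (\big[setI/setT]_(k <- J) (draw k @^-1` S k)) =
  (\prod_(k <- J) pmf_law (F k) (S k))%E.
Proof.
(* The family [J] is completed to an initial segment by imposing no condition on the other draws,
   each of which contributes a factor 1. *)
move=> uJ; pose m := (\max_(k <- J) k).+1.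
have Jm k : k \in J -> (k < m)%N by move=> kJ; rewrite ltnS; exact: leq_bigmax_seq.
have := @draw_prefix m (fun k => if k \in J then S k else setT) setT measurableT.
rewrite preimage_setT setIT.
rewrite (_ : [set u | _] = \big[setI/setT]_(k <- J) (draw k @^-1` S k)).
  move=> ->; have -> : lambda setT = 1%E by exact: unit_lebesgue_setT.
  rewrite mule1 (bigID (fun k => k \in J)) /= [X in (_ * X)%E]big1 ?mule1.
    rewrite (eq_bigr (fun k => pmf_law (F k) (S k))); last by move=> k ->.
    rewrite -big_filter; apply: perm_big; apply: uniq_perm => //.
      by rewrite filter_uniq // iota_uniq.
    move=> k; rewrite mem_filter mem_index_iota /=.
    by case: (boolP (k \in J)) => // /Jm ->.
  by move=> k /negbTE ->; rewrite pmf_law_setT.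
apply/seteqP; split => u.
  move=> H; apply/bigsetIP => k kJ.
  by have := H k (Jm k kJ); rewrite kJ.
move=> /bigsetIP H k _; case: ifP => // kJ; exact: H.
Qed.

End splitting.

(** * Mass functions: given law, uniform, geometric *)

Section pmf_examples.
Context {R : realType}.

(** Meant for sets with many elements of which at most [a] has positive mass, such as all integers
    with a given residue under a uniform law. *)
Lemma pmf_law_single (f : nat -> R) (S : set nat) (a : nat) :
  (forall n, S n -> n != a -> f n = 0) -> 0 <= f a ->
  pmf_law f S = (if a \in S then f a else 0)%:E.
Proof.
move=> fS fa; rewrite /pmf_law eseries_mkcond.
rewrite (eq_eseriesr (g := fun n => (if (n == a) && (a \in S) then f a else 0)%:E)).
  rewrite (@nneseriesD1 _ _ a) //; last by move=> k _; rewrite lee_fin; case: ifP.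
  by rewrite eqxx /= eseries0 ?adde0 // => k _ /= /negbTE ->.
move=> n _; case: (eqVneq n a) => [->|na] /=; first by case: ifP.
by case: ifPn => // /set_mem Sn; rewrite fS.
Qed.

Lemma pmf_law_set1 (f : nat -> R) a : 0 <= f a -> pmf_law f [set a] = (f a)%:E.
Proof.
move=> fa; rewrite (@pmf_law_single _ _ a) //; first by rewrite mem_set.
by move=> n /= ->; rewrite eqxx.
Qed.

Definition probability_pmf (mu : probability nat R) (n : nat) : R := fine (mu [set n]).

Lemma probability_pmfE (mu : probability nat R) n :
  (probability_pmf mu n)%:E = mu [set n].
Proof. by rewrite fineK // fin_num_measure. Qed.

Lemma is_pmf_probability (mu : probability nat R) : is_pmf (probability_pmf mu).
Proof.
split=> [n|]; first exact: fine_ge0.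
have E : (\sum_(n <oo) mu [set n])%E = 1%E.
  rewrite -(probability_setT mu) (_ : setT = \bigcup_n [set n]); last first.
    by rewrite bigcup_imset1 image_id.
  by rewrite measure_semi_bigcup // => i j _ _ [k [/= -> ->]].
have : (EFin \o series (probability_pmf mu)) n @[n --> \oo] --> 1%E.
  have -> : EFin \o series (probability_pmf mu) =
      (fun n => \sum_(0 <= k < n) mu [set k])%E.
    apply/funext => n /=; rewrite -sumEFin.
    by apply: eq_bigr => k _; exact: probability_pmfE.
  by rewrite -E; apply: is_cvg_nneseries.
by move=> /fine_cvg.
Qed.

Definition uniform_pmf (d n : nat) : R := (n < d)%N%:R / d%:R.

Lemma is_pmf_uniform d : (0 < d)%N -> is_pmf (uniform_pmf d).
Proof.
move=> d0; split=> [n|]; first by rewrite /uniform_pmf divr_ge0.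
apply: cvg_near_cst; exists d => // n /= dn.
rewrite /series /= (big_cat_nat (n := d)) //= [X in _ + X]big1_seq ?addr0.
  rewrite (eq_big_nat _ _ (F2 := fun=> d%:R^-1)).
    rewrite sumr_const_nat subn0 -[LHS]mulr_natl divff //.
    by rewrite pnatr_eq0 -lt0n.
  by move=> i /andP[_ id]; rewrite /uniform_pmf id mul1r.
move=> i /andP[_]; rewrite mem_index_iota => /andP[di _].
by rewrite /uniform_pmf ltnNge di mul0r.
Qed.

Definition geometric_pmf (p : R) (n : nat) : R := (1 - p) * p ^+ n.

Lemma is_pmf_geometric p : 0 <= p < 1 -> is_pmf (geometric_pmf p).
Proof.
move=> /andP[p0 p1]; split=> [n|].
  by rewrite mulr_ge0 ?exprn_ge0 // subr_ge0 ltW.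
rewrite -[1 in X in _ --> X](@divff _ (1 - p)) ?subr_eq0 ?gt_eqF //.
by apply: cvg_geometric_series; rewrite ger0_norm.
Qed.

End pmf_examples.

(** * Construction of the model *)

Lemma mkseq_eqP (T : eqType) (f : nat -> T) (x : T) (s : seq T) :
  mkseq f (size s) = s <-> (forall n, (n < size s)%N -> f n = nth x s n).
Proof.
split=> [<- n|H]; first by rewrite size_mkseq => ns; rewrite nth_mkseq.
apply: (@eq_from_nth _ x); rewrite size_mkseq // => n ns.
by rewrite nth_mkseq // H.
Qed.

Section model.
Context {R : realType} (G : graph) (deg : nat) (code : G -> nat).
Hypothesis code_inj : injective code.
Hypothesis deg_gt0 : (0 < deg)%N.
Hypothesis regular : forall x : G, size (nbrs x) = deg.
Variables (p : R) (mu : probability nat R).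
Hypothesis p01 : 0 <= p < 1.

Local Notation Omega := (measurableTypeR R).
Local Notation P := (@unit_lebesgue R : probability (measurableTypeR R) R).
Local Notation draw_index := (nat * G * nat * nat)%type.

(* A draw is indexed by its kind (0: number of particles, 1: step of a walk,
   2: lifetime), a site, a particle and a time. *)
Definition index_code (q : draw_index) : nat :=
  let: (t, x, i, n) := q in pickle (t, code x, i, n).

Lemma index_code_inj : injective index_code.
Proof.
move=> [[[t x] i] n] [[[t' x'] i'] n'] /= /(pcan_inj (@pickleK _)).
by move=> [-> /code_inj -> -> ->].
Qed.

(** Indices that code no draw also get the geometric law, because the extraction needs a genuine
    mass function at every index. *)
Definition draw_pmf (k : nat) : nat -> R :=
  match (unpickle k : option (nat * nat * nat * nat)) with
  | Some (0%N, _, _, _) => probability_pmf mu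
  | Some (1%N, _, _, _) => uniform_pmf deg
  | _ => geometric_pmf p
  end.

Lemma is_pmf_draw k : is_pmf (draw_pmf k).
Proof.
have mu_pmf := is_pmf_probability mu.
have deg_pmf := @is_pmf_uniform R deg deg_gt0.
have p_pmf := is_pmf_geometric p01.
by rewrite /draw_pmf; case: (unpickle k) => [[[[[|[|t]] x] i] n]|].
Qed.

Definition model_draw (q : draw_index) : Omega -> nat := draw draw_pmf (index_code q).

Lemma model_draw_independent (J : seq draw_index) (S : draw_index -> set nat) : uniq J ->
  P (\big[setI/setT]_(q <- J) (model_draw q @^-1` S q)) =
  (\prod_(q <- J) pmf_law (draw_pmf (index_code q)) (S q))%E.
Proof.
move=> uJ; pose S' k := \bigcup_(q in [set q | index_code q = k]) S q.
have S'E q : S' (index_code q) = S q.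
  apply/seteqP; split => m; first by move=> [q' /= /index_code_inj ->].
  by move=> Sm; exists q.
have := @draw_independent _ _ is_pmf_draw (map index_code J) S'.
rewrite map_inj_uniq; last exact: index_code_inj.
move=> /(_ uJ); rewrite !big_map.
by under eq_bigr do rewrite S'E; under [in RHS]eq_bigr do rewrite S'E.
Qed.

Lemma model_draw_law q S :
  P (model_draw q @^-1` S) = pmf_law (draw_pmf (index_code q)) S.
Proof.
by have := @model_draw_independent [:: q] (fun=> S) isT; rewrite !big_seq1.
Qed.

Definition draw_events (q : draw_index) : set (set Omega) :=
  [set model_draw q @^-1` S | S in [set: set nat]].

Lemma draw_events_measurable q : draw_events q `<=` measurable.
Proof. by move=> _ [S _ <-]; exact: measurable_draw. Qed.

Lemma draw_eventsI q : setI_closed (draw_events q).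
Proof. by move=> _ _ [S _ <-] [S' _ <-]; exists (S `&` S'). Qed.

Lemma draw_events_independent : mutually_independent P draw_events.
Proof.
move=> J A uJ JA.
have /choice [S SA] q : exists S, q \in J -> model_draw q @^-1` S = A q.
  by case: (boolP (q \in J)) => [/JA [S _ <-]|_]; [exists S|exists setT].
rewrite (eq_big_seq (fun q => model_draw q @^-1` S q)); last first.
  by move=> q /SA.
rewrite model_draw_independent //; apply: eq_big_seq => q /SA <-.
by rewrite model_draw_law.
Qed.

Definition draw_source (q : draw_index) : source G :=
  match q with
  | (0%N, x, _, _) => inl x
  | (1%N, x, i, _) => inr (inl (x, i))
  | (_, x, i, _) => inr (inr (x, i))
  end.

(** Reduction modulo [deg] makes every trajectory a nearest-neighbour path for every sample point
    and not just almost surely, which the speed bound later relies on. *)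
Fixpoint model_walk (x : G) (i : nat) (u : Omega) (n : nat) : G :=
  if n is m.+1 then
    let y := model_walk x i u m in
    nth y (nbrs y) (model_draw (1%N, x, i, m) u %% deg)
  else x.

(** As [p < 1], all lifetimes may be taken finite. The geometric draw starts at 0 and a lifetime at
    1, whence the shift. *)
Definition model_configuration (u : Omega) : configuration G := {|
  occ x := model_draw (0%N, x, 0%N, 0%N) u;
  traj x i n := model_walk x i u n;
  life x i := Some (model_draw (2%N, x, i, 0%N) u).+1 |}.

Lemma model_walk_step x i u n :
  model_walk x i u n.+1 \in nbrs (model_walk x i u n).
Proof. by rewrite mem_nth // regular ltn_mod. Qed.

Lemma countable_sites : countable [set: G].
Proof. by apply/countable_injP; exists code => x y _ _; exact: code_inj. Qed.

Definition block (k : source G) : set (set Omega) :=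
  <<s \bigcup_(q in [set q | draw_source q = k]) draw_events q >>.

Lemma block_draw q S : block (draw_source q) (model_draw q @^-1` S).
Proof. by apply: sub_sigma_algebra; exists q => //; exists S. Qed.

(** A position is not a single draw: it is decomposed over the countably many possible previous
    positions, given which one further draw decides it. *)
Lemma source_events_block k : source_events model_configuration k `<=` block k.
Proof.
case: k => [x|[[x i]|[x i]]] A /=.
- by move=> [n _ <-]; exact: (@block_draw (0%N, x, 0%N, 0%N) [set n]).
- move=> [n [y ->]]; elim: n y => [|n IH] y /=.
    have [->|xy] := pselect (x = y).
      rewrite (_ : [set _ | _] = setT); last by apply/seteqP.
      exact: (@measurableT _ (g_sigma_algebraType _)).
    rewrite (_ : [set _ | _] = set0); last by apply/seteqP; split.
    exact: (@measurable0 _ (g_sigma_algebraType _)).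
  rewrite (_ : [set _ | _] = \bigcup_z ([set w | model_walk x i w n = z] `&`
      (model_draw (1%N, x, i, n) @^-1` [set m | nth z (nbrs z) (m %% deg) = y]))).
    apply: (@countable_bigcupT_measurable _ (g_sigma_algebraType _)).
      exact: countable_sites.
    move=> z; apply: (@measurableI _ (g_sigma_algebraType _)); first exact: IH.
    exact: (@block_draw (1%N, x, i, n)).
  apply/seteqP; split => w /=; first by move=> H; exists (model_walk x i w n).
  by move=> [z _ /= [-> ]].
- move=> [l _ <-].
  exact: (@block_draw (2%N, x, i, 0%N) [set m | Some m.+1 = l]).
Qed.

Lemma block_measurable k : block k `<=` measurable.
Proof.
by apply: sub_measurable_sigma => A [q _]; exact: draw_events_measurable.
Qed.

Lemma uniform_step (y z : G) :
  pmf_law (uniform_pmf deg) [set m | nth y (nbrs y) (m %% deg) = z] =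
  (if z \in nbrs y then (size (nbrs y))%:R^-1 else 0 : R)%:E.
Proof.
rewrite (@pmf_law_single _ _ _ (index z (nbrs y))).
- rewrite regular; case: (boolP (z \in nbrs y)) => zy.
    have iz : (index z (nbrs y) < deg)%N by rewrite -(regular y) index_mem.
    rewrite mem_set /=; last by rewrite modn_small // nth_index.
    by rewrite /uniform_pmf iz mul1r.
  rewrite memNset //= => zE; move/negP: zy; apply.
  by rewrite -zE mem_nth // regular ltn_mod.
- move=> m /= mz; rewrite /uniform_pmf; case: ltnP => md; last by rewrite mul0r.
  rewrite modn_small // in mz; rewrite -mz index_uniq ?eqxx ?regular //.
  exact: nbrs_uniq.
- by rewrite /uniform_pmf divr_ge0.
Qed.

Lemma srw_prob_nth (x : G) (s : seq G) : srw_prob R x s =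
  \prod_(n < size s) (let y := nth x (x :: s) n in
    if nth x s n \in nbrs y then (size (nbrs y))%:R^-1 else 0).
Proof.
elim: s x => [|y s IH] x /=; first by rewrite big_ord0.
rewrite big_ord_recl /= IH; congr (_ * _); apply: eq_bigr => n _ /=.
rewrite (set_nth_default x y (ltn_ord n)).
by rewrite (set_nth_default x y (s := y :: s) (n := n)) //= ltnS ltnW.
Qed.

(** Once the whole path is prescribed, the current position is known at each time, so the event
    splits into one condition per step draw and independence applies. *)
Lemma model_walk_prefix x i s :
  [set w | mkseq (model_walk x i w) (size s).+1 = x :: s] =
  \big[setI/setT]_(n <- iota 0 (size s)) (model_draw (1%N, x, i, n) @^-1`
    [set m | let y := nth x (x :: s) n in nth y (nbrs y) (m %% deg) = nth x s n]).
Proof.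
apply/seteqP; split => w /=.
  move=> /(@mkseq_eqP _ _ x (x :: s)) H; apply/bigsetIP => n.
  rewrite mem_iota /= => ns.
  by have /= <- := H n.+1 ns; have /= <- := H n (ltnW ns).
move=> /bigsetIP H; apply/(@mkseq_eqP _ _ x (x :: s)); elim=> [_|n IH ns]; first by [].
have ns' : n \in iota 0 (size s) by rewrite mem_iota.
have /= := H n ns'.
rewrite -(IH (ltnW ns)); exact.
Qed.

Lemma is_frog_model_configuration : is_frog_model P model_configuration p mu.
Proof.
split.
- by move=> k A /source_events_block /block_measurable.
- move=> x n; rewrite [LHS](model_draw_law (0%N, x, 0%N, 0%N) [set n]).
  rewrite /draw_pmf /= pickleK pmf_law_set1 ?probability_pmfE //.
  exact: fine_ge0.
- move=> x i s; rewrite [X in P X]model_walk_prefix.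
  pose S (q : draw_index) := [set m | let y := nth x (x :: s) q.2 in
    nth y (nbrs y) (m %% deg) = nth x s q.2].
  have := @model_draw_independent [seq (1%N, x, i, n) | n <- iota 0 (size s)] S.
  rewrite map_inj_uniq; last by move=> n m [].
  rewrite iota_uniq !big_map => -> //.
  rewrite srw_prob_nth -prodEFin -(big_mkord xpredT (fun n => 
    (let y := nth x (x :: s) n in
    if nth x s n \in nbrs y then (size (nbrs y))%:R^-1 else 0)%:E)).
  rewrite /index_iota subn0; apply: eq_bigr => n _ /=.
  by rewrite /draw_pmf /= pickleK -uniform_step.
- move=> x i k.
  rewrite (_ : [set _ | _] = model_draw (2%N, x, i, 0%N) @^-1` [set k]); last first.
    by apply/seteqP; split => w /=; [move=> [->]|move=> ->].
  rewrite model_draw_law /draw_pmf /= pickleK pmf_law_set1 //.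
  by have [] := is_pmf_geometric p01.
- by move=> p1; move: p01; rewrite p1 ltxx andbF.
(* The sigma-algebra of each source is contained in that of the draws defining it, and distinct
   sources use disjoint sets of draws. *)
- apply: (mutually_independent_sub (F' := block)).
    move=> k; apply: smallest_sub; last exact: source_events_block.
    exact: smallest_sigma_algebra.
  apply: mutually_independent_block.
  + exact: draw_events_measurable.
  + exact: draw_eventsI.
  + by move=> k l _ _ [q [/= <- <-]].
  + exact: draw_events_independent.
Qed.

End model.

(** * Hitting probabilities of the walk *)

Section walks.
Context (R : realType) {G : graph}.

Fixpoint walks (n : nat) (x : G) : seq (seq G) :=
  if n is m.+1 then flatten [seq [seq y :: s | s <- walks m y] | y <- nbrs x]
  else [:: [::]].

Lemma mem_walks n x s : (s \in walks n x) =
  (size s == n) && path (fun a b : G => b \in nbrs a) x s.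
Proof.
elim: n x s => [|n IH] x [|y s] //=.
  by apply/negbTE/flatten_mapP => -[y _ /mapP[]].
rewrite eqSS andbCA -IH; apply/flatten_mapP/andP.
  by move=> [z zx /mapP[t tz [-> ->]]].
by move=> [yx sy]; exists y => //; apply: map_f.
Qed.

Lemma walks_uniq n x : uniq (walks n x).
Proof.
elim: n x => //= n IH x.
have: uniq (nbrs x) := nbrs_uniq x.
elim: (nbrs x) => //= y ys IHy /andP[yys uys].
rewrite cat_uniq map_inj_uniq ?IH ?IHy ?andbT //=; last by move=> ? ? [].
apply/hasPn => _ /flatten_mapP[z zys /mapP[t _ ->]].
by apply/mapP => -[t' _ [zy _]]; rewrite -zy zys in yys.
Qed.

Lemma sum_walks_recl n x (F : seq G -> R) :
  \sum_(s <- walks n.+1 x) F s =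
  \sum_(y <- nbrs x) \sum_(s <- walks n y) F (y :: s).
Proof.
by rewrite /= big_flatten big_map; apply: eq_bigr => y _; rewrite big_map.
Qed.

Lemma srw_prob_ge0 (x : G) s : 0 <= srw_prob R x s.
Proof. by elim: s x => //= y s IH x; rewrite mulr_ge0 //; case: ifP. Qed.

(** Probability that the walk from [x] meets [D] within [n] steps, written as a finite sum over
    paths so that it refers to no probability space. *)
Definition hitting_prob n x (D : pred G) : R :=
  \sum_(s <- walks n x) (if has D (x :: s) then srw_prob R x s else 0).

Lemma hitting_prob_ge0 n x D : 0 <= hitting_prob n x D.
Proof. by apply: sumr_ge0 => s _; case: ifP => // _; exact: srw_prob_ge0. Qed.

(** One-step analysis; only an inequality, since [x] itself may belong to [D]. *)
Lemma hitting_prob_step n x (D : pred G) :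
  (size (nbrs x))%:R^-1 * \sum_(y <- nbrs x) hitting_prob n y D <=
  hitting_prob n.+1 x D.
Proof.
rewrite /hitting_prob sum_walks_recl mulr_sumr big_seq [leRHS]big_seq.
apply: ler_sum => y yx; rewrite mulr_sumr; apply: ler_sum => s _ /=.
case: (D y || _); last by rewrite mulr0 orbF; case: ifP; rewrite ?yx ?mulr_ge0 ?srw_prob_ge0.
by rewrite orbT yx.
Qed.

Lemma sum_srw_prob n (x : G) : (forall y : G, (0 < size (nbrs y))%N) ->
  \sum_(s <- walks n x) srw_prob R x s = 1.
Proof.
move=> deg0; elim: n x => [|n IH] x; first by rewrite /= big_seq1.
rewrite sum_walks_recl big_seq.
rewrite (eq_bigr (fun=> (size (nbrs x))%:R^-1)) => [|y yx] /=.
  rewrite -big_seq big_const_seq count_predT iter_addr_0 -[LHS]mulr_natl divff //.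
  by rewrite pnatr_eq0 -lt0n.
by rewrite -mulr_sumr IH yx mulr1.
Qed.

End walks.

Section hitting.
Context {R : realType} {d : nat} (d_ge2 : (1 < d)%N) (d_ge3 : (3 <= d)%N).
Local Notation G := (Td d_ge2).
Implicit Types u x y : G.

Lemma parent_sorted (u : word d) : sorted (fun a b => a != b) (behead (val u)).
Proof. by case: u => -[|a s] //=; exact: path_sorted. Qed.

Definition parent (u : G) : G := exist _ (behead (val u)) (parent_sorted u).

Lemma parent_nbr u : val u != [::] -> u \in nbrs (parent u).
Proof.
rewrite /= mem_word_nbrs /=; case: (val u) => [|a s] //= _.
by rewrite eqxx orbT.
Qed.

Lemma nbrP x y : y \in nbrs x ->
  y = parent x /\ val x != [::] \/ exists a, val y = a :: val x.
Proof.
rewrite /= mem_word_nbrs => /orP[] /andP[].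
  by case: x => -[|a s] //= xs _ /eqP E; left; split => //; exact/val_inj.
by case: y => -[|a s] //= ys _ /eqP ->; right; exists a.
Qed.

Definition descendant_at u (k : nat) : pred G :=
  [pred z : G | suffix (val u) (val z) && (size (val z) == size (val u) + k)%N].

(* The rate 17/18 comes from the test function (3/4)^j, which the biased walk
   contracts by at least that factor when d >= 3; 1 - 2^-j is subharmonic. *)
Lemma hitting_prob_ge u (L k m : nat) x : val u != [::] ->
  suffix (val u) (val x) -> size (val x) = (size (val u) + k)%N -> (k <= L)%N ->
  1 - (1 / 2) ^+ k.+1 - (17 / 18) ^+ m * (4 / 3) ^+ L.+1 * (3 / 4) ^+ k.+1 <=
  hitting_prob R m x (descendant_at u L).
Proof.
move=> u0.
have degE y : size (nbrs y) = d := Td_degree y.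
have deg0 (y : G) : (0 < size (nbrs y))%N by rewrite degE ltnW.
have pow_ge0 (a : R) n : 0 <= a -> 0 <= a ^+ n by move=> a0; rewrite exprn_ge0.
have B0 n j : 0 <= (17 / 18 : R) ^+ n * (4 / 3) ^+ L.+1 * (3 / 4) ^+ j.
  by apply: mulr_ge0; [apply: mulr_ge0|]; apply: pow_ge0; lra.
have A0 j : 0 <= (1 / 2 : R) ^+ j by apply: pow_ge0; lra.
have hasD y s : suffix (val u) (val y) -> size (val y) = (size (val u) + L)%N ->
    has (descendant_at u L) (y :: s).
  move=> uy sy; apply/hasP; exists y; rewrite ?mem_head //.
  by apply/andP; split => //; exact/eqP.
elim: m k x => [|m IH] k x ux sx; rewrite leq_eqVlt => /orP[/eqP kL|kL].
- have -> : hitting_prob R 0 x (descendant_at u L) = 1.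
    by rewrite /hitting_prob [walks 0 x]/= big_seq1 hasD // sx kL.
  have := A0 k.+1; have := B0 0%N k.+1; lra.
(* With no step left the bound is nonpositive: the last term is at least 1, because [k <= L]. *)
- apply: le_trans (hitting_prob_ge0 _ _ _ _).
  have : 1 <= (4 / 3 : R) ^+ L.+1 * (3 / 4) ^+ k.+1.
    rewrite -(subnKC (n := L.+1) (m := k.+1)) 1?ltnW //.
    rewrite exprD mulrAC -exprMn (_ : 4 / 3 * (3 / 4) = 1); last by field.
    by rewrite expr1n mul1r exprn_ege1 //; lra.
  have := A0 k.+1; rewrite expr0; lra.
- have -> : hitting_prob R m.+1 x (descendant_at u L) = 1.
    rewrite -[RHS](@sum_srw_prob R G m.+1 x deg0); apply: eq_bigr => s _.
    by rewrite hasD // sx kL.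
  have := A0 k.+1; have := B0 m.+1 k.+1; lra.
have xn0 : val x != [::].
  by move: sx; case: (val x) => //; case: (val u) u0.
apply: le_trans (hitting_prob_step _ _ _ _).
(* The index [j] is the height above the parent of [u], so [x] has index [k.+1]. The last term pays
   for the walks that are still between the two barriers after [m] steps. *)
pose g j : R := 1 - (1 / 2) ^+ j - (17 / 18) ^+ m * (4 / 3) ^+ L.+1 * (3 / 4) ^+ j.
have par : parent x \in nbrs x by rewrite word_nbrs_sym; exact: parent_nbr.
have gpar : g k <= hitting_prob R m (parent x) (descendant_at u L).
  (* For [k = 0] the parent of [x] is outside the subtree of [u]. The walk is given up there,
     consistently with [g 0] being nonpositive. *)
  case: k sx kL => [|k] sx kL.
    apply: le_trans (hitting_prob_ge0 _ _ _ _); rewrite /g !expr0.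
    have := B0 m 0%N; rewrite expr0; lra.
  apply: IH; last exact: ltnW (ltnW kL).
    move: ux sx => /=; case: (val x) xn0 => // a w _ /suffixP [[|b t] ->].
      by rewrite size_cat /= => /eqP; rewrite -[X in X == _]addn0 eqn_add2l.
    by move=> _ /=; exact: suffix_suffix.
  by rewrite /= size_behead sx addnS.
have gchild y : y \in nbrs x -> y != parent x ->
    g k.+2 <= hitting_prob R m y (descendant_at u L).
  move=> /nbrP [[-> _]|[a ya] _]; first by rewrite eqxx.
  apply: IH => //.
    by rewrite ya; case/suffixP: ux => t ->; rewrite -cat_cons; exact: suffix_suffix.
  by rewrite ya /= sx addnS.
have sum_ge : g k + d.-1%:R * g k.+2 <=
    \sum_(y <- nbrs x) hitting_prob R m y (descendant_at u L).
  rewrite (bigD1_seq (parent x)) ?nbrs_uniq //=; apply: lerD => //.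
  have -> : d.-1%:R * g k.+2 = \sum_(y <- nbrs x | y != parent x) g k.+2.
    rewrite big_const_seq iter_addr_0 mulr_natl; congr (_ *+ _).
    have := count_predC (pred1 (parent x)) (nbrs x).
    rewrite count_uniq_mem ?nbrs_uniq // par degE /= => dE.
    by apply: succn_inj; rewrite prednK ?(ltnW d_ge2) // -add1n -dE.
  rewrite big_seq_cond [leRHS]big_seq_cond; apply: ler_sum => y /andP[].
  exact: gchild.
rewrite degE; apply: le_trans (ler_wpM2l _ sum_ge); last by rewrite invr_ge0.
have dE : (d.-1%:R : R) = d%:R - 1 by rewrite -subn1 natrB // ltnW.
have d3 : 3 <= (d%:R : R) by rewrite ler_nat.
have mean (a b D : R) : D != 0 ->
    D^-1 * (a + (D - 1) * b) = D^-1 * a + b - D^-1 * b by move=> D0; field.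
rewrite dE mean; last by apply: lt0r_neq0; lra.
have e3 : (d%:R : R)^-1 <= 1 / 3.
  by rewrite div1r lef_pV2 // posrE; lra.
(* Here [e] stands for [1 / d]. The two sides differ by [(1/3 - e) * (3/4 * A + 7/16 * B)], so
   [d = 3] is the extreme case; [17/24] is [17/18 * 3/4]. *)
have drift (A B e : R) : 0 <= A -> 0 <= B -> e <= 1 / 3 ->
    1 - 1 / 2 * A - 17 / 24 * B <= e * (1 - A - B) +
      (1 - 1 / 4 * A - 9 / 16 * B) - e * (1 - 1 / 4 * A - 9 / 16 * B).
  move=> A_ge0 B_ge0 e_le; have : e * (3 / 4 * A + 7 / 16 * B) <=
      1 / 3 * (3 / 4 * A + 7 / 16 * B) by apply: ler_wpM2r => //; lra.
  lra.
have := drift _ _ _ (A0 k) (B0 m k) e3.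
rewrite /g (exprS _ m) !(exprS (3 / 4)) !(exprS (1 / 2)).
set C := (4 / 3) ^+ L.+1; set D := (17 / 18) ^+ m.
set A := (1 / 2) ^+ k; set B := (3 / 4) ^+ k.
set e := d%:R^-1.
by congr (_ <= _); field.
Qed.

(** The first step leads to [u] with probability [1 / d]. From there the previous bound with [k = 0]
    gives [1 - 1/2 - 1/3 * 3/4 = 1/4] as soon as [M] is large. *)
Lemma hitting_prob_parent (L : nat) : exists M : nat, forall u, val u != [::] ->
  1 / (4 * d%:R) <= hitting_prob R M (parent u) (descendant_at u L).
Proof.
have [M HM] : exists M, (17 / 18 : R) ^+ M * (4 / 3) ^+ L.+1 <= 1 / 3.
  have c : (fun n => (4 / 3) ^+ L.+1 * (17 / 18 : R) ^+ n) @ \oo --> (0 : R).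
    by apply: cvg_geometric; rewrite ger0_norm; lra.
  have [N _ HN] := cvgr_lt _ c (1 / 3) ltac:(lra).
  by exists N; have := HN N (leqnn N); rewrite mulrC => /ltW.
exists M.+1 => u u0; apply: le_trans (hitting_prob_step _ _ _ _).
have -> : size (nbrs (parent u)) = d := Td_degree _.
have := @hitting_prob_ge u L 0 M u u0 (suffix_refl _) (esym (addn0 _)) (leq0n _).
rewrite !expr1 => H.
have : 1 / 4 <= \sum_(y <- nbrs (parent u)) hitting_prob R M y (descendant_at u L).
  rewrite (bigD1_seq u) ?nbrs_uniq //=; last exact: parent_nbr.
  have : 0 <= \sum_(i <- nbrs (parent u) | i != u) hitting_prob R M i (descendant_at u L).
    by apply: sumr_ge0 => y _; exact: hitting_prob_ge0.
  lra.
rewrite invfM mulrA => H4; rewrite mulrC; apply: ler_wpM2l.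
  by rewrite invr_ge0.
by rewrite -[X in X <= _]mulr1 mulrC div1r in H4 *.
Qed.

End hitting.

(** * Activation times and survival *)

Section ereal_inf_nat.
Context {R : realType}.
Implicit Types (S : set (\bar R)).

Definition nat_or_infty (e : \bar R) : Prop := e = +oo%E \/ exists n : nat, e = n%:R%:E.

(** Times are infima in the extended reals but only take natural values or [+oo], so a finite
    infimum is attained. This turns them into minima, over which one can reason and take countable
    unions. *)
Lemma ereal_inf_nat S : (forall e, S e -> nat_or_infty e) ->
  ereal_inf S = +oo%E \/ exists2 n : nat, S n%:R%:E & ereal_inf S = n%:R%:E.
Proof.
move=> Snat; have [ex|nex] := pselect (exists n : nat, `[< S n%:R%:E >]).
  right; case: (ex_minnP ex) => n /asboolP Sn nmin; exists n => //.
  apply/eqP; rewrite eq_le; apply/andP; split; first exact: ereal_inf_lbound.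
  apply: le_ereal_inf_tmp => e Se; have [->|[m em]] := Snat _ Se; first by rewrite leey.
  by rewrite em lee_fin ler_nat nmin //; apply/asboolP; rewrite -em.
left; apply/eqP; rewrite -leye_eq; apply: le_ereal_inf_tmp => e Se.
have [->//|[m em]] := Snat _ Se.
by case: nex; exists m; apply/asboolP; rewrite -em.
Qed.

Lemma ereal_inf_natE S (n : nat) : (forall e, S e -> nat_or_infty e) ->
  ereal_inf S = n%:R%:E <->
  S n%:R%:E /\ forall m : nat, (m < n)%N -> ~ S m%:R%:E.
Proof.
move=> Snat; split.
  move=> Sn; split.
    have [|[m Sm]] := ereal_inf_nat Snat; first by rewrite Sn.
    by rewrite Sn => -[] /eqP; rewrite eqr_nat => /eqP ->.
  move=> m mn Sm; have := ereal_inf_lbound Sm.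
  by rewrite Sn lee_fin ler_nat leqNgt mn.
move=> [Sn nmin]; have [E|[m Sm E]] := ereal_inf_nat Snat.
  by have := ereal_inf_lbound Sn; rewrite E leye_eq.
have := ereal_inf_lbound Sn; rewrite E lee_fin ler_nat leq_eqVlt.
by move=> /orP[/eqP -> //|/nmin].
Qed.

Lemma nat_or_inftyD (a b : \bar R) :
  nat_or_infty a -> nat_or_infty b -> nat_or_infty (a + b)%E.
Proof.
move=> [->|[n ->]] [->|[m ->]]; [by left..|].
by right; exists (n + m)%N; rewrite -EFinD -natrD.
Qed.

End ereal_inf_nat.

Lemma alive_le m n l : (m <= n)%N -> alive n l -> alive m l.
Proof. by case: l => //= k; exact: leq_ltn_trans. Qed.

Section activation.
Context {R : realType} {G : graph} (c : configuration G).
Local Notation passage := (@passage_time R G c).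
Local Notation chain := (@chain_time R G c).
Local Notation T := (@activation_time R G c).

Definition visits (x y : G) (n : nat) : Prop :=
  exists i, [/\ (i < occ c x)%N, alive n (life c x i) & traj c x i n = y].

Definition proper_chain (s : seq G) : bool :=
  path (fun a b : G => a != b) (origin G) s.

Lemma passage_time_set_nat x y (e : \bar R) :
  [set n%:R%:E | n in [set n | visits x y n]] e -> nat_or_infty e.
Proof. by move=> [n _ <-]; right; exists n. Qed.

Lemma passage_time_nat x y : nat_or_infty (passage x y).
Proof.
have [E|[n _ E]] := ereal_inf_nat (@passage_time_set_nat x y); first by left.
by right; exists n.
Qed.

Lemma passage_timeE x y (n : nat) : passage x y = n%:R%:E <->
  visits x y n /\ forall m, (m < n)%N -> ~ visits x y m.
Proof.
have inj (m : nat) : [set (n%:R%:E : \bar R) | n in [set n | visits x y n]] m%:R%:E <->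
    visits x y m.
  split; last by exists m.
  by move=> [k vk [/eqP]]; rewrite eqr_nat => /eqP <-.
rewrite /passage_time (ereal_inf_natE _ (@passage_time_set_nat x y)).
split=> [[/inj vn nmin]|[vn nmin]]; split => //; first by move=> m /nmin; rewrite inj.
  exact/inj.
by move=> m /nmin; rewrite inj.
Qed.

Lemma passage_time_le x y n : visits x y n -> (passage x y <= n%:R%:E)%E.
Proof. by move=> vn; apply: ereal_inf_lbound; exists n. Qed.

Lemma chain_time_nat x s : nat_or_infty (chain x s).
Proof.
elim: s x => [|y s IH] x /=; first by right; exists 0%N.
by apply: nat_or_inftyD; [exact: passage_time_nat|exact: IH].
Qed.

Lemma chain_time_rcons x s y :
  chain x (rcons s y) = (chain x s + passage (last x s) y)%E.
Proof.
elim: s x => [|z s IH] x /=; first by rewrite addeC.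
by rewrite IH addeA.
Qed.

Lemma activation_time_set_nat x (e : \bar R) :
  [set chain (origin G) s | s in
    [set s | proper_chain s /\ last (origin G) s = x]] e -> nat_or_infty e.
Proof. by move=> [s _ <-]; exact: chain_time_nat. Qed.

Lemma activation_time_nat x : T x = +oo%E \/
  exists2 n : nat, T x = n%:R%:E & exists s, [/\ proper_chain s,
    last (origin G) s = x & chain (origin G) s = n%:R%:E].
Proof.
have [E|[n [s [ps ls] cs] E]] := ereal_inf_nat (@activation_time_set_nat x).
  by left.
by right; exists n => //; exists s.
Qed.

Lemma activation_timeE x (n : nat) : T x = n%:R%:E <->
  (exists s, [/\ proper_chain s, last (origin G) s = x &
    chain (origin G) s = n%:R%:E]) /\
  forall m, (m < n)%N -> ~ exists s, [/\ proper_chain s, last (origin G) s = x &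
    chain (origin G) s = m%:R%:E].
Proof.
rewrite /activation_time (ereal_inf_natE _ (@activation_time_set_nat x)).
split=> -[H nmin]; split.
- by have [s [ps ls] cs] := H; exists s.
- by move=> m /nmin H' [s [ps ls cs]]; apply: H'; exists s.
- by have [s [ps ls cs]] := H; exists s.
- by move=> m /nmin H' [s [ps ls] cs]; apply: H'; exists s.
Qed.

Lemma activation_time_origin : (T (origin G) <= 0)%E.
Proof. by apply: ereal_inf_lbound; exists [::]. Qed.

Lemma activation_time_step x y (a n : nat) : T x = a%:R%:E -> visits x y n ->
  (T y <= (a + n)%N%:R%:E)%E.
Proof.
(* Consecutive sites of a chain must differ, so a particle visiting its own site is treated
   apart. *)
move=> Tx vn; have [<-|xy] := eqVneq x y.
  by rewrite Tx lee_fin ler_nat leq_addr.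
have [|[b]] := activation_time_nat x; first by rewrite Tx.
rewrite Tx => -[/eqP]; rewrite eqr_nat => /eqP <- {b} [s [ps ls cs]].
apply: (@le_trans _ _ (chain (origin G) (rcons s y))).
  apply: ereal_inf_lbound; exists (rcons s y) => //; split; last by rewrite last_rcons.
  by rewrite rcons_path ls xy andbT; exact: ps.
by rewrite chain_time_rcons cs ls natrD EFinD leeD2l // passage_time_le.
Qed.

Lemma activation_time_visit x y n :
  (T x < +oo)%E -> visits x y n -> (T y < +oo)%E.
Proof.
have [->|[a Tx _]] := activation_time_nat x; first by rewrite ltxx.
by move=> _ /(activation_time_step Tx) /le_lt_trans; apply; rewrite ltry.
Qed.

Lemma finite_chain_crossing (Q : G -> Prop) x s : (chain x s < +oo)%E ->
  Q x -> ~ Q (last x s) ->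
  exists y z, [/\ Q y, ~ Q z & (passage y z < +oo)%E].
Proof.
elim: s x => [|y s IH] x //= fin Qx Qs.
have [pa|pa] := pselect (passage x y < +oo)%E; last first.
  exfalso; move: fin; have [->|[n E]] := passage_time_nat x y.
    by have [->|[m ->]] := chain_time_nat y s; rewrite ltxx.
  by case: pa; rewrite E ltry.
have [Qy|nQy] := pselect (Q y); last by exists x, y.
apply: (IH y) => //; move: fin; have [->|[m ->]] := chain_time_nat y s; last by rewrite ltry.
by have [->|[n ->]] := passage_time_nat x y; rewrite ltxx.
Qed.

Section speed.
Variable level : G -> nat.
Hypothesis level_origin : level (origin G) = 0%N.
Hypothesis level_nbr : forall x y, y \in nbrs x -> (level y <= (level x).+1)%N.
Hypothesis traj0 : forall x i, traj c x i 0 = x.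
Hypothesis trajS : forall x i n, traj c x i n.+1 \in nbrs (traj c x i n).

Lemma level_traj x i n : (level (traj c x i n) <= level x + n)%N.
Proof.
elim: n => [|n IH]; first by rewrite traj0 addn0.
by rewrite addnS (leq_trans (level_nbr (trajS x i n))).
Qed.

Lemma level_passage x y : ((level y)%:R%:E <= (level x)%:R%:E + passage x y)%E.
Proof.
have [->|[n E]] := passage_time_nat x y; first by rewrite addey // leey.
rewrite E; have /passage_timeE [[i [_ _ <-]] _] := E.
by rewrite -EFinD lee_fin -natrD ler_nat level_traj.
Qed.

Lemma level_chain x s :
  ((level (last x s))%:R%:E <= (level x)%:R%:E + chain x s)%E.
Proof.
elim: s x => [|y s IH] x /=; first by rewrite adde0.
by rewrite addeA (le_trans (IH y)) // leeD2r // level_passage.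
Qed.

Lemma level_activation x : ((level x)%:R%:E <= T x)%E.
Proof.
apply: le_ereal_inf_tmp => _ [s [_ <-] <-].
by have := level_chain (origin G) s; rewrite level_origin add0e.
Qed.

(* Sites are activated at least as late as their level, so some edge of an
   activating chain is crossed exactly at any given time. *)
Lemma unbounded_activation_survives :
  (forall N : nat, exists2 z, (T z < +oo)%E & (N < level z)%N) -> survives R c.
Proof.
move=> unb N; have [z Tz Nz] := unb N.
have [E|[m Tm [s [ps ls cs]]]] := activation_time_nat z; first by rewrite E in Tz.
pose Q x := (T x <= N%:R%:E)%E.
have [|||x [y [Qx nQy pxy]]] := @finite_chain_crossing Q (origin G) s.
- by rewrite cs ltry.
- by apply: le_trans activation_time_origin _; rewrite lee_fin.
- rewrite ls /Q => /(le_trans (level_activation z)).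
  by rewrite lee_fin ler_nat leqNgt Nz.
have [E|[a Tx _]] := activation_time_nat x; first by move: Qx; rewrite /Q E.
have [E|[n pn]] := passage_time_nat x y; first by rewrite E in pxy.
have /passage_timeE [vis _] := pn; have [i [io al _]] := vis.
have aN : (a <= N)%N by move: Qx; rewrite /Q Tx lee_fin ler_nat.
(* Otherwise [y] would be activated by time [N]. Hence the particle of [x] that reaches [y] at age
   [n] is still alive at age [N - a], that is, at time [N]. *)
have Nn : (N - a <= n)%N.
  rewrite leqNgt; apply/negP => nN; apply: nQy; rewrite /Q.
  apply: le_trans (activation_time_step Tx vis) _.
  by rewrite lee_fin ler_nat -(subnKC aN) leq_add2l ltnW.
exists x, i; split => //; exists (N - a)%N; first exact: alive_le al.
by rewrite Tx -EFinD -natrD subnKC.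
Qed.

End speed.
End activation.

(** * Measurability of survival *)

Section measurability.
Context {d} {Omega : measurableType d} {R : realType} {G : graph}.
Variables (C : Omega -> configuration G) (code : G -> nat).
Hypothesis code_inj : injective code.

Lemma measurable_occ_lt x i : source_events C (inl x) `<=` measurable ->
  measurable [set w | (i < occ (C w) x)%N].
Proof.
move=> Cm; rewrite (_ : [set w | _] = \bigcup_(n in [set n | (i < n)%N]) [set w | occ (C w) x = n]).
  by apply: bigcup_measurable => n _; apply: Cm; exists n.
by apply/seteqP; split => w /= => [H|[n] /= ? -> //]; exists (occ (C w) x).
Qed.

Lemma measurable_alive x i n :
  source_events C (inr (inr (x, i))) `<=` measurable ->
  measurable [set w | alive n (life (C w) x i)].
Proof.
move=> Cm; rewrite (_ : [set w | _] = \bigcup_l (if alive n l then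
    [set w | life (C w) x i = l] else set0)).
  apply: countable_bigcupT_measurable => // l; case: ifP => // _.
  by apply: Cm; exists l.
apply/seteqP; split => w /=; first by move=> H; exists (life (C w) x i); rewrite ?H.
by move=> [l _]; case: ifP => // + /= ->.
Qed.

Lemma measurable_traj x i n y : source_events C (inr (inl (x, i))) `<=` measurable ->
  measurable [set w | traj (C w) x i n = y].
Proof. by apply; exists n, y. Qed.

Hypothesis C_measurable : forall k, source_events C k `<=` measurable.

Lemma measurable_visits x y n : measurable [set w | visits (C w) x y n].
Proof.
rewrite (_ : [set w | _] = \bigcup_i ([set w | (i < occ (C w) x)%N] `&`
   [set w | alive n (life (C w) x i)] `&` [set w | traj (C w) x i n = y])).
  apply: bigcupT_measurable => i; apply: measurableI; last exact/measurable_traj/C_measurable.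
  by apply: measurableI; [exact/measurable_occ_lt/C_measurable|exact/measurable_alive/C_measurable].
apply/seteqP; split => w /=; first by move=> [i [? ? ?]]; exists i.
by move=> [i _ [[? ?] ?]]; exists i.
Qed.

Lemma measurable_least (E : nat -> set Omega) n : (forall m, measurable (E m)) ->
  measurable [set w | E n w /\ forall m, (m < n)%N -> ~ E m w].
Proof.
move=> mE; rewrite (_ : [set w | _] =
  E n `&` \bigcap_(m in [set m | (m < n)%N]) ~` E m) //.
apply: measurableI => //; apply: bigcap_measurableType => m _.
exact: measurableC.
Qed.

Lemma measurable_passage_time x y n :
  measurable [set w | passage_time (R := R) (C w) x y = n%:R%:E].
Proof.
rewrite (_ : [set w | _] = [set w | visits (C w) x y n /\
    forall m, (m < n)%N -> ~ visits (C w) x y m]).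
  by apply: (measurable_least (E := fun m => [set w | visits (C w) x y m])) => m;
    exact: measurable_visits.
by apply/seteqP; split => w /= /passage_timeE.
Qed.

Lemma measurable_chain_time x s n :
  measurable [set w | chain_time (R := R) (C w) x s = n%:R%:E].
Proof.
elim: s x n => [|y s IH] x n /=.
  have [->|n0] := eqVneq n 0%N.
    by rewrite (_ : [set w | _] = setT) //; apply/seteqP.
  rewrite (_ : [set w | _] = set0) //; apply/seteqP; split => // w /= [/eqP].
  by rewrite eq_sym pnatr_eq0 (negbTE n0).
rewrite (_ : [set w | _] = \bigcup_a \bigcup_b (if (a + b == n)%N then
    [set w | passage_time (R := R) (C w) x y = a%:R%:E] `&`
    [set w | chain_time (R := R) (C w) y s = b%:R%:E] else set0)).
  apply: bigcupT_measurable => a; apply: bigcupT_measurable => b.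
  by case: ifP => // _; apply: measurableI => //; exact: measurable_passage_time.
apply/seteqP; split => w /=.
  have [->|[a Ea]] := passage_time_nat (R := R) (C w) x y.
    by have [->|[b ->]] := chain_time_nat (R := R) (C w) y s.
  have [->|[b Eb]] := chain_time_nat (R := R) (C w) y s; first by rewrite Ea.
  rewrite Ea Eb -EFinD -natrD => -[/eqP]; rewrite eqr_nat => ab.
  by exists a => //; exists b => //; rewrite ab.
move=> [a _ [b _]]; case: eqP => // <- [-> ->].
by rewrite -EFinD -natrD.
Qed.

Lemma measurable_activation_time x n :
  measurable [set w | activation_time (R := R) (C w) x = n%:R%:E].
Proof.
pose E m := \bigcup_s (if proper_chain s && (last (origin G) s == x) then
  [set w | chain_time (R := R) (C w) (origin G) s = m%:R%:E] else set0).
have EE m w : E m w <-> exists s, [/\ proper_chain s, last (origin G) s = x &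
    chain_time (R := R) (C w) (origin G) s = m%:R%:E].
  split; first by move=> [s _]; case: ifP => // /andP[ps /eqP ls] /= cs; exists s.
  by move=> [s [ps ls cs]]; exists s; rewrite // ps ls eqxx.
rewrite (_ : [set w | _] = [set w | E n w /\ forall m, (m < n)%N -> ~ E m w]).
  apply: measurable_least => m; apply: countable_bigcupT_measurable.
    apply/countable_injP; exists (fun s => pickle (map code s)).
    by move=> s t _ _ /(pcan_inj (@pickleK _)) /(inj_map code_inj).
  by move=> s; case: ifP => // _; exact: measurable_chain_time.
apply/seteqP; split => w /=.
  move=> /activation_timeE [H nmin]; split; first exact/EE.
  by move=> m /nmin + /EE.
move=> [/EE H nmin]; apply/activation_timeE; split => // m /nmin H' /EE.
exact: H'.
Qed.

(** Needed because survival will be bounded below by the probability of a smaller event, and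
    monotonicity requires both events to be measurable. *)
Lemma measurable_survives : measurable [set w | survives R (C w)].
Proof.
rewrite (_ : [set w | _] = \bigcap_n \bigcup_x \bigcup_i
  ([set w | (i < occ (C w) x)%N] `&` \bigcup_k
    ([set w | alive k (life (C w) x i)] `&` \bigcup_a (if (a + k == n)%N then
     [set w | activation_time (R := R) (C w) x = a%:R%:E] else set0)))).
  apply: bigcapT_measurable => n; apply: countable_bigcupT_measurable.
    by apply/countable_injP; exists code => x y _ _; exact: code_inj.
  move=> x; apply: bigcupT_measurable => i.
  apply: measurableI; first exact/measurable_occ_lt/C_measurable.
  apply: bigcupT_measurable => k; apply: measurableI; first exact/measurable_alive/C_measurable.
  apply: bigcupT_measurable => a; case: ifP => // _.
  exact: measurable_activation_time.
apply/seteqP; split => w /= H n.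
  move=> _; have [x [i [io [k al]]]] := H n.
  have [->//|[a Ta _]] := activation_time_nat (R := R) (C w) x.
  rewrite Ta -EFinD -natrD => -[/eqP]; rewrite eqr_nat => ak.
  exists x => //; exists i => //; split => //; exists k => //; split => //.
  by exists a => //; rewrite ak.
have [x _ [i _ [io [k _ [al [a _]]]]]] := H n I.
case: eqP => // <- /= Ta; exists x, i; split => //; exists k => //.
by rewrite Ta -EFinD -natrD.
Qed.

End measurability.

(** * Subtrees of the offspring *)

Section numeric.
Context {R : realFieldType}.

Lemma bernoulli_add (e : R) n : 0 <= e -> 1 + n%:R * e <= (1 + e) ^+ n.
Proof.
move=> e0; elim: n => [|n IH]; first by rewrite mul0r addr0 expr0.
rewrite exprS; apply: le_trans (ler_wpM2l _ IH); last by rewrite addr_ge0.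
have : 0 <= n%:R * e * e by rewrite !mulr_ge0.
rewrite -natr1; nra.
Qed.

Lemma bernoulli_sub (e : R) n : 0 <= e <= 1 -> 1 - n%:R * e <= (1 - e) ^+ n.
Proof.
move=> /andP[e0 e1]; elim: n => [|n IH]; first by rewrite mul0r subr0 expr0.
rewrite exprS; apply: le_trans (ler_wpM2l _ IH); last by rewrite subr_ge0.
have : 0 <= n%:R * e * e by rewrite !mulr_ge0.
rewrite -natr1; nra.
Qed.

(** The product with [(1 + 1/n)^n] is at most 1, and that factor is at least 2 by Bernoulli's
    inequality. *)
Lemma expr_one_minus_inv (n : nat) : (0 < n)%N -> (1 - n%:R^-1) ^+ n <= 1 / 2 :> R.
Proof.
move=> n0; have nR : 0 < (n%:R : R) by rewrite ltr0n.
have e0 : 0 <= (n%:R : R)^-1 by rewrite invr_ge0 ltW.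
have e1 : (n%:R : R)^-1 <= 1 by rewrite invf_le1 // ler1n.
have H : (1 - n%:R^-1) ^+ n * (1 + n%:R^-1) ^+ n <= 1 :> R.
  rewrite -exprMn exprn_ile1 //.
    by rewrite mulr_ge0 ?subr_ge0 // addr_ge0.
  have : 0 <= (n%:R : R)^-1 * n%:R^-1 by rewrite mulr_ge0.
  nra.
have H2 : 2 <= (1 + n%:R^-1) ^+ n :> R.
  by apply: le_trans (bernoulli_add n e0); rewrite divff ?gt_eqF.
have H3 : 0 <= (1 - n%:R^-1) ^+ n :> R by rewrite exprn_ge0 // subr_ge0.
nra.
Qed.

End numeric.

Section offspring.
Context {d : nat} (d_ge2 : (1 < d)%N) (d_ge3 : (3 <= d)%N).
Local Notation G := (Td d_ge2).
Implicit Types (u x y z : G) (s w : seq 'I_d).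

Lemma suffix_consE w (a : 'I_d) s :
  suffix w (a :: s) = (w == a :: s) || suffix w s.
Proof.
apply/suffixP/orP => [[[|b t] /= E]|[/eqP ->|/suffixP[t ->]]].
- by left; rewrite E.
- by right; apply/suffixP; case: E => _ ->; exists t.
- by exists [::].
- by exists (a :: t).
Qed.

(** The words ending in [w] form the subtree below [w], which a nearest-neighbour path can only
    enter through its top. *)
Lemma walk_enters w x (p : seq G) z : path (fun a b : G => b \in nbrs a) x p ->
  ~~ suffix w (val x) -> z \in x :: p -> suffix w (val z) ->
  exists2 y, y \in x :: p & val y = w.
Proof.
move=> + + + wz; elim: p x => [|y p IH] x /=.
  by move=> _ wx; rewrite inE => /eqP zx; rewrite -zx wz in wx.
move=> /andP[xy py] wx; rewrite inE => /orP[/eqP zx|zp].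
  by rewrite -zx wz in wx.
have [wy|wy] := boolP (suffix w (val y)); last first.
  by have [y' y'p <-] := IH y py wy zp; exists y' => //; rewrite inE y'p orbT.
exists y; first by rewrite !inE eqxx orbT.
have [[yE _]|[a ya]] := nbrP xy.
  case/negP: wx; apply: suffix_trans wy _.
  by rewrite yE -[val (parent x)]drop1; exact: suffix_drop.
by move: wy; rewrite ya suffix_consE (negbTE wx) orbF => /eqP ->.
Qed.

Definition default_letter : 'I_d := Ordinal (ltnW d_ge2).

(** A child off the geodesic must avoid two letters: that of the child on the geodesic and the first
    letter of its own parent. Three letters suffice, and this is where [d >= 3] enters the
    branching. *)
Definition fresh s : 'I_d := odflt default_letter [pick c | c \notin s].

Lemma freshP s : (size s < d)%N -> fresh s \notin s.
Proof.
move=> sd; rewrite /fresh; case: pickP => //= H.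
have : (#|'I_d| <= size s)%N.
  rewrite cardE; apply: uniq_leq_size; first exact: enum_uniq.
  by move=> c _; have := H c => /negbFE.
by rewrite card_ord leqNgt sd.
Qed.

(* The j-th offspring found on the geodesic ending at z: its parent is the
   (j+1)-th ancestor of z, and it branches off the geodesic there. *)
Definition offspring_word z (j : nat) : seq 'I_d :=
  fresh (take 2 (drop j (val z))) :: drop j.+1 (val z).

Lemma offspring_sorted z j : (j < size (val z))%N ->
  sorted (fun a b => a != b) (offspring_word z j).
Proof.
move=> jz; have srt : sorted (fun a b : 'I_d => a != b) (drop j.+1 (val z)).
  exact/drop_sorted/(valP z).
have fr : fresh (take 2 (drop j (val z))) \notin take 2 (drop j (val z)).
  apply: freshP; apply: leq_ltn_trans d_ge3.
  by rewrite size_take; case: ltnP.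
move: fr srt; rewrite /offspring_word (drop_nth default_letter jz).
case: (drop j.+1 (val z)) => //= b t.
by rewrite take0 !inE => /norP[_ ->].
Qed.

Definition offspring z (j : nat) : G := insubd (empty_word d) (offspring_word z j).

(** The sites whose randomness decides the success of [u]: its subtree and its parent, where the
    particle starting the generation sleeps. *)
Definition territory u : pred G :=
  [pred x : G | (x == parent u) || suffix (val u) (val x)].

Section one_geodesic.
Variables (u z : G) (L : nat).
Hypothesis u0 : val u != [::].
Hypothesis uz : suffix (val u) (val z).
Hypothesis sz : size (val z) = (size (val u) + L)%N.

Lemma val_offspring j : (j < L)%N -> val (offspring z j) = offspring_word z j.
Proof.
move=> jL; apply: insubdK; apply: offspring_sorted.
by rewrite sz ltn_addl.
Qed.

Lemma val_parent_offspring j : (j < L)%N ->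
  val (parent (offspring z j)) = drop j.+1 (val z).
Proof. by move=> jL; rewrite /= val_offspring. Qed.

Lemma suffix_geodesic j : (j <= L)%N -> suffix (val u) (drop j (val z)).
Proof.
move=> jL; have -> : val u = drop L (val z).
  by case/suffixP: uz sz => t -> /=; rewrite size_cat addnC => /addnI <-; rewrite drop_size_cat.
by rewrite -(subnK jL) -drop_drop; exact: suffix_drop.
Qed.

Lemma territory_offspring_suffix j x : (j < L)%N -> territory (offspring z j) x ->
  suffix (drop j.+1 (val z)) (val x).
Proof.
move=> jL /orP[/eqP ->|]; first by rewrite val_parent_offspring // suffix_refl.
rewrite val_offspring // => /suffixP[t ->].
by rewrite /offspring_word -cat_rcons; exact: suffix_suffix.
Qed.

Lemma territory_offspring j x : (j < L)%N -> territory (offspring z j) x ->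
  suffix (val u) (val x).
Proof.
move=> jL /(territory_offspring_suffix jL); apply: suffix_trans.
exact: suffix_geodesic.
Qed.

Lemma territory_offspring_sub j x : (j < L)%N -> territory (offspring z j) x ->
  territory u x.
Proof. by move=> jL tx; apply/orP; right; exact: territory_offspring tx. Qed.

Lemma territory_offspring_parent j : (j < L)%N ->
  ~~ territory (offspring z j) (parent u).
Proof.
move=> jL; apply/negP => /(territory_offspring jL) /size_suffix /=.
by rewrite size_behead leqNgt ltn_predL lt0n size_eq0 u0.
Qed.

(** The parent of the offspring is too short a word to lie below the [j]-th ancestor of [z], and the
    other sites carry the fresh letter where that ancestor has another one. *)
Lemma territory_offspring_notin j x : (j < L)%N -> territory (offspring z j) x ->
  ~~ suffix (drop j (val z)) (val x).
Proof.
move=> jL tx; apply/negP => /suffixP[t xt].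
have jz : (j < size (val z))%N by rewrite sz ltn_addl.
case/orP: tx => [/eqP xp|].
  have := congr1 size xt; rewrite xp val_parent_offspring // size_cat !size_drop.
  move/eqP; rewrite -(subnSK jz) addnS.
  by rewrite ltn_eqF // ltnS leq_addl.
rewrite val_offspring // => /suffixP[t']; rewrite xt /offspring_word.
set c := fresh _; have cN : c \notin take 2 (drop j (val z)).
  apply: freshP; apply: leq_ltn_trans d_ge3.
  by rewrite size_take; case: ltnP.
move: cN; rewrite (drop_nth default_letter jz) -!cat_rcons => cN /eqP E.
have st : size t = size t'.
  have := congr1 size (eqP E); rewrite !size_cat !size_rcons => /eqP.
  by rewrite eqn_add2r eqSS => /eqP.
move: E; rewrite eqseq_cat ?size_rcons ?st // eqseq_rcons => /andP[/andP[_ /eqP ac] _].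
by move: cN; rewrite ac /= inE eqxx.
Qed.

(** For [i < j] the territory of the [i]-th offspring lies below the [j]-th ancestor of [z], which
    the territory of the [j]-th offspring avoids. *)
Lemma territory_offspring_disjoint i j x : (i < L)%N -> (j < L)%N ->
  territory (offspring z i) x -> territory (offspring z j) x -> i = j.
Proof.
wlog ij : i j / (i <= j)%N.
  by case: (leqP i j) => [ij /(_ i j ij)|/ltnW ij /(_ j i ij) H iL jL ti tj];
    [exact|rewrite (H jL iL)].
move=> iL jL ti tj; move: ij; rewrite leq_eqVlt => /orP[/eqP //|ij].
case/negP: (territory_offspring_notin jL tj).
apply: suffix_trans (territory_offspring_suffix iL ti).
by rewrite -(subnK ij) -drop_drop; exact: suffix_drop.
Qed.

End one_geodesic.
End offspring.

(** * Probability estimates for one generation *)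

Section probability_bounds.
Context {dO} {Omega : measurableType dO} {R : realType} (P : probability Omega R).

Lemma probability_bigsetU_seq (I : eqType) (s : seq I) (X : I -> set Omega) :
  uniq s -> (forall i, i \in s -> measurable (X i)) ->
  (forall i j w, i \in s -> j \in s -> X i w -> X j w -> i = j) ->
  P (\big[setU/set0]_(i <- s) X i) = (\sum_(i <- s) P (X i))%E.
Proof.
elim: s => [|a s IH] /=; first by rewrite !big_nil measure0.
move=> /andP[nas us] mX dX; rewrite !big_cons.
have mX' i : i \in s -> measurable (X i).
  by move=> si; apply: mX; rewrite inE si orbT.
rewrite measureU.
- congr (_ + _)%E; apply: IH => // i j w si sj.
  by apply: dX; rewrite inE ?si ?sj orbT.
- by apply: mX; rewrite mem_head.
- by rewrite big_seq; apply: bigsetU_measurable.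
- apply/seteqP; split => // w [Xa /bigsetUP[i si Xi]].
  have ai : a = i by apply: (dX _ _ w); rewrite ?mem_head // inE si orbT.
  by move: nas; rewrite ai si.
Qed.

(** Complements turn the union into an intersection, for which independence gives a product of at
    most [(1 - e) ^+ L]. *)
Lemma independent_bigcup_ge (B : set Omega) (E : nat -> set Omega) (L : nat)
    (e : R) : measurable B -> (forall j, (j < L)%N -> measurable (E j)) ->
  e <= 1 -> (forall j, (j < L)%N -> (e%:E <= P (E j))%E) ->
  P (B `&` \big[setI/setT]_(j <- iota 0 L) ~` E j) =
    (P B * \prod_(j <- iota 0 L) P (~` E j))%E ->
  (P B * (1 - (1 - e) ^+ L)%:E <= P (B `&` \bigcup_(j in [set j | j < L]%N) E j))%E.
Proof.
move=> mB mE e1 Ee indep.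
set Z := \big[setI/setT]_(j <- iota 0 L) ~` E j in indep *.
have mZ : measurable Z.
  rewrite /Z big_seq; apply: bigsetI_measurable => j; rewrite mem_iota => jL.
  by apply: measurableC; exact: mE.
have -> : \bigcup_(j in [set j | (j < L)%N]) E j = ~` Z.
  apply/seteqP; split => w.
    move=> [j /= jL Ej] /bigsetIP /(_ j); rewrite mem_iota => /(_ jL); exact.
  move=> nZ; apply: contrapT => nE; apply: nZ; apply/bigsetIP => j.
  by rewrite mem_iota => jL Ej; apply: nE; exists j.
have -> : P (B `&` ~` Z) = (P B - P B * \prod_(j <- iota 0 L) P (~` E j))%E.
  by rewrite -indep -setDE measureD // ltey_eq fin_num_measure.
pose f j : R := fine (P (~` E j)).
have fE j : (j < L)%N -> P (~` E j) = (f j)%:E.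
  by move=> jL; rewrite fineK // fin_num_measure //; apply: measurableC; exact: mE.
have f0 j : 0 <= f j by rewrite fine_ge0.
have f1 j : (j < L)%N -> f j <= 1 - e.
  move=> jL; rewrite -lee_fin -fE // probability_setC; last exact: mE.
  by rewrite EFinB leeB // Ee.
rewrite (eq_big_seq (fun j => (f j)%:E)); last first.
  by move=> j; rewrite mem_iota => jL; exact: fE.
rewrite prodEFin -(fineK (fin_num_measure P B mB)) -!EFinM -EFinB lee_fin.
rewrite mulrBr mulr1 lerB // ler_wpM2l ?fine_ge0 //.
have -> : (1 - e) ^+ L = \prod_(j <- iota 0 L) (1 - e).
  by rewrite big_const_seq count_predT size_iota iter_mulr_1.
rewrite big_seq [leRHS]big_seq; apply: ler_prod => j; rewrite mem_iota => jL.
by rewrite f0 f1.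
Qed.

End probability_bounds.

Section model_bounds.
Context {dO} {Omega : measurableType dO} {R : realType} {G : graph}.
Variables (P : probability Omega R) (C : Omega -> configuration G).
Variables (p : R) (mu : probability nat R).
Hypothesis FM : is_frog_model P C p mu.

Lemma probability_occ_gt0 x :
  P [set w | (0 < occ (C w) x)%N] = (1 - mu [set 0%N])%E.
Proof.
have mo : measurable [set w | occ (C w) x = 0%N].
  by apply: (frog_measurable FM (k := inl x)); exists 0%N.
rewrite -(frog_count FM x) -probability_setC //; congr (P _).
by apply/seteqP; split => w /=; rewrite lt0n => /eqP.
Qed.

(** Only the lifetimes from [m + 1] to [n] are counted, so the sum is finite and telescopes;
    [p ^+ n] is made small afterwards. *)
Lemma probability_alive_ge x i m n : (m <= n)%N -> 0 <= p ->
  ((p ^+ m - p ^+ n)%:E <= P [set w | alive m (life (C w) x i)])%E.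
Proof.
move=> mn p0.
have ml l : measurable [set w | life (C w) x i = l].
  by apply: (frog_measurable FM (k := inr (inr (x, i)))); exists l.
have E : P (\big[setU/set0]_(k <- index_iota m n) [set w | life (C w) x i = Some k.+1]) =
    (p ^+ m - p ^+ n)%:E.
  rewrite probability_bigsetU_seq ?iota_uniq //; last first.
    by move=> k l w _ _ /= -> [].
  rewrite (eq_bigr (fun k => ((1 - p) * p ^+ k)%:E)); last first.
    by move=> k _; exact: (frog_life FM).
  rewrite sumEFin; congr EFin.
  rewrite (eq_bigr (fun k => - (p ^+ k.+1 - p ^+ k))); last first.
    by move=> k _; rewrite exprS; ring.
  by rewrite sumrN (telescope_sumr (fun k => p ^+ k) mn) opprB.
rewrite -E; apply: le_measure; rewrite ?inE.
- by apply: bigsetU_measurable.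
- exact/measurable_alive/(frog_measurable FM (k := inr (inr (x, i)))).
- move=> w /bigsetUP[k]; rewrite mem_index_iota => /andP[mk _] /= -> /=.
  by rewrite ltnS.
Qed.

End model_bounds.

(** * Successive generations *)

Section recursion.
Context {R : realType} {d : nat} (d_ge2 : (1 < d)%N) (d_ge3 : (3 <= d)%N).
Local Notation G := (Td d_ge2).
Context {dO} {Omega : measurableType dO} (P : probability Omega R).
Variables (C : Omega -> configuration G) (L M : nat).
Implicit Types (u x z : G) (s : seq G).

Definition source_site (k : source G) : G :=
  match k with inl x => x | inr (inl xi) => xi.1 | inr (inr xi) => xi.1 end.

Definition sites_sigma (A : pred G) : set (set Omega) :=
  <<s \bigcup_(k in [set k | A (source_site k)]) <<s source_events C k >> >>.

Lemma source_events_sites_sigma (A : pred G) k : A (source_site k) ->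
  source_events C k `<=` sites_sigma A.
Proof.
by move=> Ak X kX; apply: sub_sigma_algebra; exists k => //; exact: sub_sigma_algebra.
Qed.

Lemma sites_sigma_sub (A B : pred G) : (forall x, A x -> B x) ->
  sites_sigma A `<=` sites_sigma B.
Proof.
move=> AB; apply: sub_smallest2r; first exact: smallest_sigma_algebra.
by move=> X [k /= /AB Bk kX]; exists k.
Qed.

(** Prescribing all [M] steps makes the target and its offspring deterministic on the event, and
    makes the events of distinct walks disjoint. *)
Definition starts u s : set Omega :=
  [set w | (0 < occ (C w) (parent u))%N] `&`
  [set w | alive M (life (C w) (parent u) 0)] `&`
  [set w | mkseq (traj (C w) (parent u) 0) (size s).+1 = parent u :: s].

Lemma traj_prefixE x i s :
  [set w | mkseq (traj (C w) x i) (size s).+1 = x :: s] =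
  \big[setI/setT]_(n <- iota 0 (size s).+1) [set w | traj (C w) x i n = nth x (x :: s) n].
Proof.
apply/seteqP; split => w; last first.
  move=> /bigsetIP H; apply/(@mkseq_eqP _ _ x (x :: s)) => n ns.
  by apply: H; rewrite mem_iota.
move=> H; have {}H := (@mkseq_eqP _ _ x (x :: s)).1 H; apply/bigsetIP => n.
by rewrite mem_iota => /andP[_ ns]; exact: H.
Qed.

Lemma starts_sigma u s : sites_sigma (pred1 (parent u)) (starts u s).
Proof.
set F := sites_sigma _.
have sub k : source_site k = parent u -> source_events C k `<=` F.
  by move=> ku; apply: source_events_sites_sigma; rewrite /= ku eqxx.
(* Taken as the measurable sets of a space [T], the events of the generated sigma-algebra fall under
   the measurability lemmas for the model. *)
pose T := g_sigma_algebraType (\bigcup_(k in [set k | pred1 (parent u) (source_site k)])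
  <<s source_events C k >>).
apply: (@measurableI _ T); first apply: (@measurableI _ T).
- exact: (@measurable_occ_lt _ T G C (parent u) 0 (sub (inl (parent u)) erefl)).
- exact: (@measurable_alive _ T G C (parent u) 0 M
    (sub (inr (inr (parent u, 0%N))) erefl)).
rewrite traj_prefixE; apply: (@bigsetI_measurable _ T) => n _.
exact: (@measurable_traj _ T G C (parent u) 0 n _
  (sub (inr (inl (parent u, 0%N))) erefl)).
Qed.

Definition target u s : G :=
  nth (parent u) (parent u :: s) (find (descendant_at u L) (parent u :: s)).

Definition good_walks u : seq (seq G) :=
  [seq s <- walks M (parent u) | has (descendant_at u L) (parent u :: s)].

(* [reaches n u] is witnessed by n successive generations: each particle is the
   first one of its site, and walks during M steps to a site at depth L. *)
Fixpoint reaches (n : nat) u : set Omega :=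
  if n is m.+1 then \big[setU/set0]_(s <- good_walks u) (starts u s `&`
    \bigcup_(j in [set j | (j < L)%N]) reaches m (offspring (target u s) j))
  else setT.

Lemma targetP u s : s \in good_walks u -> [/\ target u s \in parent u :: s,
  suffix (val u) (val (target u s)) &
  size (val (target u s)) = (size (val u) + L)%N].
Proof.
rewrite mem_filter => /andP[H _].
have /andP[uz /eqP sz] := nth_find (parent u) H.
by split => //; rewrite mem_nth // -has_find.
Qed.

Lemma good_walkP u s : s \in good_walks u ->
  size s = M /\ path (fun a b : G => b \in nbrs a) (parent u) s.
Proof.
rewrite mem_filter => /andP[_ sw].
have : (size s == M) && path (fun a b : G => b \in nbrs a) (parent u) s.
  by rewrite -mem_walks.
by move=> /andP[/eqP].
Qed.

Lemma offspring_neq0 u s j : s \in good_walks u -> (j < L)%N ->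
  val (offspring (target u s) j) != [::].
Proof.
by move=> /targetP[_ uz sz] jL; rewrite (@val_offspring _ _ d_ge3 u _ L).
Qed.

Lemma reaches_sigma n u : val u != [::] -> sites_sigma (territory u) (reaches n u).
Proof.
elim: n u => [|n IH] u u0 /=; first exact: (@measurableT _ (g_sigma_algebraType _)).
rewrite big_seq; apply: (@bigsetU_measurable _ (g_sigma_algebraType _)) => s gs.
have [_ uz sz] := targetP gs.
apply: (@measurableI _ (g_sigma_algebraType _)).
  have sub : sites_sigma (pred1 (parent u)) `<=` sites_sigma (territory u).
    by apply: sites_sigma_sub => x /eqP ->; rewrite /territory /= eqxx.
  exact: (sub _ (@starts_sigma u s)).
apply: (@bigcup_measurable _ (g_sigma_algebraType _)) => j /= jL.
have sub : sites_sigma (territory (offspring (target u s) j)) `<=`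
    sites_sigma (territory u).
  by apply: sites_sigma_sub => x; exact: (territory_offspring_sub d_ge3 uz sz jL).
exact: (sub _ (IH _ (offspring_neq0 gs jL))).
Qed.

Lemma reaches_decreasing n u : reaches n.+1 u `<=` reaches n u.
Proof.
elim: n u => [|n IH] u w //= /bigsetUP[s gs [ws [j jL wr]]].
apply/bigsetUP; exists s => //; split => //; exists j => //.
exact: IH.
Qed.

Lemma reaches_activation n u w : val u != [::] -> reaches n u w ->
  (activation_time (R := R) (C w) (parent u) < +oo)%E ->
  exists2 z : G, (activation_time (R := R) (C w) z < +oo)%E &
    (size (val (parent u)) + n <= size (val z))%N.
Proof.
elim: n u => [|n IH] u u0; first by move=> _ Tu; exists (parent u); rewrite ?addn0.
move=> /bigsetUP[s gs [[[occ0 al] tr] [j /= jL wr]]] Tu.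
have [zs uz sz] := targetP gs.
set o := offspring _ j in wr.
have o0 : val o != [::] := offspring_neq0 gs jL.
have vo : val (parent o) = drop j.+1 (val (target u s)).
  exact: (val_parent_offspring d_ge3 sz jL).
have so : (size (val u) <= size (val (parent o)))%N.
  by rewrite vo; exact: size_suffix (suffix_geodesic uz sz jL).
clearbody o.
have su : size (val u) = (size (val (parent u))).+1.
  by rewrite /= size_behead prednK // lt0n size_eq0.
have [sM ps] := good_walkP gs.
(* The walk starts strictly above the parent of the offspring and reaches a site below it, so it
   passes through that parent and wakes it up. *)
have [y ys vy] : exists2 y, y \in parent u :: s & val y = val (parent o).
  apply: (walk_enters ps _ zs); last by rewrite vo; exact: suffix_drop.
  by apply/negP => /size_suffix; rewrite leqNgt -su so.
have {}vy : y = parent o by exact: val_inj.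
have iM : (index y (parent u :: s) < size (parent u :: s))%N by rewrite index_mem.
have vis : visits (C w) (parent u) (parent o) (index y (parent u :: s)).
  exists 0%N; split => //.
    by apply: alive_le al; rewrite -sM; exact: iM.
  have trE := (@mkseq_eqP _ _ (parent u) (parent u :: s)).1 tr.
  by rewrite trE // nth_index.
have [z Tz nz] := IH o o0 wr (activation_time_visit Tu vis).
exists z => //; apply: leq_trans nz.
by rewrite addnS -addSn -su leq_add2r.
Qed.

Section model.
Variables (p : R) (mu : probability nat R).
Hypothesis FM : is_frog_model P C p mu.

Lemma sites_sigma_measurable A : sites_sigma A `<=` measurable.
Proof.
apply: sub_measurable_sigma => X [k _]; apply: sub_measurable_sigma.
exact: (frog_measurable FM).
Qed.

Lemma probability_starts u s :
  P (starts u s) = (P [set w | (0 < occ (C w) (parent u))%N] *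
    P [set w | alive M (life (C w) (parent u) 0)] *
    (srw_prob R (parent u) s)%:E)%E.
Proof.
set v := parent u; rewrite -(frog_traj FM v 0).
pose k1 : source G := inl v; pose k2 : source G := inr (inr (v, 0%N)).
pose k3 : source G := inr (inl (v, 0%N)).
pose A (k : source G) : set Omega := match k with
  | inl _ => [set w | (0 < occ (C w) v)%N]
  | inr (inr _) => [set w | alive M (life (C w) v 0)]
  | inr (inl _) => [set w | mkseq (traj (C w) v 0) (size s).+1 = v :: s]
  end.
have := frog_independent FM (J := [:: k1; k2; k3]) (A := A) isT.
rewrite !big_cons !big_nil setIT mule1 setIA muleA; apply => k.
have sub k' : source_events C k' `<=` <<s source_events C k' >>.
  by move=> X; exact: sub_sigma_algebra.
rewrite !inE => /or3P[] /eqP ->.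
- exact: (@measurable_occ_lt _ (g_sigma_algebraType (source_events C k1)) G C v 0 (sub k1)).
- exact: (@measurable_alive _ (g_sigma_algebraType (source_events C k2)) G C v 0 M (sub k2)).
rewrite /A /k3 traj_prefixE.
apply: (@bigsetI_measurable _ (g_sigma_algebraType (source_events C k3))) => n _.
exact: (@measurable_traj _ (g_sigma_algebraType (source_events C k3)) G C v 0 n _ (sub k3)).
Qed.

Lemma starts_offspring_independent n u s : val u != [::] -> s \in good_walks u ->
  let E j := reaches n (offspring (target u s) j) in
  P (starts u s `&` \big[setI/setT]_(j <- iota 0 L) ~` E j) =
  (P (starts u s) * \prod_(j <- iota 0 L) P (~` E j))%E.
Proof.
move=> u0 gs E; have [_ uz sz] := targetP gs.
(* Block 0 holds the sources at the parent of [u], block [j + 1] those of the [j]-th offspring.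
   Blocks beyond [L] are made empty so that the whole sequence is disjoint. *)
pose D (k : nat) : set (source G) :=
  if k is j.+1 then [set x | (j < L)%N && territory (offspring (target u s) j) (source_site x)]
  else [set x | source_site x == parent u].
have tD : trivIset setT D.
  have ne k j : D 0%N k -> D j.+1 k -> False.
    move=> /= /eqP -> /andP[jL]; apply/negP.
    exact: (territory_offspring_parent d_ge3 u0 uz sz jL).
  move=> [|i] [|j] _ _ // [x []].
  - by move=> D0 /(ne _ _ D0).
  - by move=> Di /ne /(_ Di).
  - move=> /= /andP[iL ti] /andP[jL tj]; congr S.
    exact: (territory_offspring_disjoint d_ge3 sz iL jL ti tj).
have Fm k : <<s source_events C k >> `<=` measurable.
  by apply: sub_measurable_sigma; exact: (frog_measurable FM).
have FI k : setI_closed <<s source_events C k >>.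
  exact: (@measurableI _ (g_sigma_algebraType (source_events C k))).
have indep := mutually_independent_block Fm FI tD (frog_independent FM).
pose A (k : nat) : set Omega := if k is j.+1 then ~` E j else starts u s.
have uJ : uniq (0%N :: map S (iota 0 L)).
  rewrite /= map_inj_uniq ?iota_uniq ?andbT; last exact: succn_inj.
  by apply/mapP => -[].
have := indep _ A uJ; rewrite !big_cons !big_map; apply => k.
rewrite inE => /orP[/eqP -> /=|/mapP[j]]; first exact: starts_sigma.
rewrite mem_iota add0n => /andP[_ jL] -> /=.
have -> : [set x | (j < L)%N && territory (offspring (target u s) j) (source_site x)] =
    [set x | territory (offspring (target u s) j) (source_site x)].
  by apply/seteqP; split => x /=; rewrite jL.
apply: (@measurableC _ (g_sigma_algebraType _)).
exact: (reaches_sigma n (offspring_neq0 gs jL)).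
Qed.

End model.
End recursion.

(** * Lower bound for all generations, choice of constants, conclusion *)

Section lower_bound.
Context {R : realType} {d : nat} (d_ge2 : (1 < d)%N) (d_ge3 : (3 <= d)%N).
Local Notation G := (Td d_ge2).
Context {dO} {Omega : measurableType dO} (P : probability Omega R).
Variables (C : Omega -> configuration G) (L M : nat).
Variables (p : R) (mu : probability nat R).
Hypothesis FM : is_frog_model P C p mu.
Variables q a h e : R.
Hypotheses (q0 : 0 <= q) (a0 : 0 <= a) (e01 : 0 <= e <= 1).
Hypothesis occ_ge : forall x, (q%:E <= P [set w | (0 < occ (C w) x)%N])%E.
Hypothesis alive_ge : forall x i, (a%:E <= P [set w | alive M (life (C w) x i)])%E.
Hypothesis hit_ge : forall u : G, val u != [::] ->
  h <= hitting_prob R M (parent u) (descendant_at u L).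
Hypothesis fixpoint : e <= q * a * h * (1 - (1 - e) ^+ L).

(** For each good walk, independence bounds its term by the probability of the walk times
    [q * a * (1 - (1 - e) ^+ L)]. The terms are disjoint and the walk probabilities add up to the
    hitting probability, so [fixpoint] closes the induction. *)
Lemma probability_reaches_ge n (u : G) : val u != [::] ->
  (e%:E <= P (reaches C L M n u))%E.
Proof.
have /andP[e0 e1] := e01.
elim: n u => [|n IH] u u0 /=; first by rewrite probability_setT lee_fin.
have mr m v : val v != [::] -> measurable (reaches C L M m v).
  by move=> v0; exact: (sites_sigma_measurable FM (reaches_sigma d_ge3 L M m v0)).
have ms s : measurable (starts C M u s).
  by apply: (sites_sigma_measurable FM); exact: starts_sigma.
have mE s : s \in good_walks L M u -> measurable (starts C M u s `&`
    \bigcup_(j in [set j | (j < L)%N]) reaches C L M n (offspring (target L u s) j)).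
  move=> gs; apply: measurableI => //; apply: bigcup_measurable => j jL.
  apply: mr; exact: (offspring_neq0 d_ge3 gs jL).
rewrite probability_bigsetU_seq //; last 2 first.
- exact/filter_uniq/walks_uniq.
- move=> s t w /good_walkP[sM _] /good_walkP[tM _].
  by move=> [[_ /=]]; rewrite sM => Es _ [[_ /=]]; rewrite tM Es => -[].
have c0 : 0 <= 1 - (1 - e) ^+ L.
  by rewrite subr_ge0 exprn_ile1 // ?subr_ge0 // lerBlDr lerDl.
have term s : s \in good_walks L M u ->
    ((q * a * srw_prob R (parent u) s * (1 - (1 - e) ^+ L))%:E <=
     P (starts C M u s `&` \bigcup_(j in [set j | (j < L)%N])
        reaches C L M n (offspring (target L u s) j)))%E.
  move=> gs; apply: le_trans (independent_bigcup_ge (e := e) _ _ _ _ _) => //.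
  - rewrite (probability_starts M FM) EFinM lee_wpmul2r ?lee_fin //.
    rewrite EFinM lee_wpmul2r ?lee_fin ?srw_prob_ge0 // EFinM.
    by apply: lee_pmul => //; rewrite lee_fin.
  - by move=> j jL; apply: mr; exact: (offspring_neq0 d_ge3 gs jL).
  - by move=> j jL; apply: IH; exact: (offspring_neq0 d_ge3 gs jL).
  - exact: (starts_offspring_independent d_ge3 FM n u0 gs).
apply: (@le_trans _ _ (\sum_(s <- good_walks L M u)
    (q * a * srw_prob R (parent u) s * (1 - (1 - e) ^+ L))%:E)%E); last first.
  by rewrite big_seq [leRHS]big_seq; apply: lee_sum => s; exact: term.
rewrite sumEFin lee_fin -mulr_suml -mulr_sumr.
apply: le_trans fixpoint _; apply: ler_wpM2r => //.
apply: ler_wpM2l; first exact: mulr_ge0.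
apply: le_trans (hit_ge u0) _.
by rewrite /hitting_prob /good_walks big_filter [leRHS]big_mkcond.
Qed.

End lower_bound.

(** With [p = 1 - 1 / (4 * (M + 1))], Bernoulli's inequality gives [p ^+ M >= 3/4], and [K] is taken
    so large that [p ^+ K < 1/4]. *)
Lemma geometric_parameter (R : realType) (M : nat) : exists p : R, exists2 K : nat,
  0 <= p < 1 & (M <= K)%N /\ 1 / 2 <= p ^+ M - p ^+ K.
Proof.
pose e : R := (4 * M.+1%:R)^-1.
have M0 : 0 < (M.+1%:R : R) by rewrite ltr0n.
have e0 : 0 < e by rewrite invr_gt0 mulr_gt0.
have M1 : 1 <= (M.+1%:R : R) by rewrite ler1n.
have eM : M.+1%:R * e = 1 / 4 by rewrite /e; field; exact: lt0r_neq0.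
have e1 : e <= 1 / 4 by rewrite -eM ler_peMl // ltW.
have pM : 3 / 4 <= (1 - e) ^+ M.
  have e01 : 0 <= e <= 1 by apply/andP; split; lra.
  by apply: le_trans (bernoulli_sub M e01); move: eM; rewrite -natr1; lra.
have c : (fun n => 1 * (1 - e) ^+ n) @ \oo --> (0 : R).
  by apply: cvg_geometric; rewrite ger0_norm; lra.
have [N _ HN] := cvgr_lt _ c (1 / 4) ltac:(lra).
exists (1 - e), (maxn M N); first by apply/andP; split; lra.
split; first exact: leq_maxl.
by have := HN (maxn M N) (leq_maxr M N); rewrite /= mul1r; lra.
Qed.

Theorem theorem1p5 (R : realType) (dT : measure_display)
    (T : measurableType dT) (P : probability T R) (eta : {RV P >-> nat})
    (eta_pos : (0 < P [set w : T | (1 <= eta w)%N])%E)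
    (d : nat) (d_ge3 : (3 <= d)%N) :
  (critical_parameter (Td (ltnW d_ge3)) (distribution P eta) < 1)%E.
Proof.
set G := Td _; pose mu : probability nat R := distribution P eta.
have regular (x : G) : size (nbrs x) = d := Td_degree x.
have code_inj : injective (fun x : G => pickle (val x)).
  by move=> x y /(pcan_inj (@pickleK _)) /val_inj.
have d0 : (0 < d)%N by rewrite (leq_trans _ d_ge3).
have dR : 0 < (d%:R : R) by rewrite ltr0n.
pose q : R := fine (1 - mu [set 0%N])%E.
have qE : q%:E = (1 - mu [set 0%N])%E.
  by rewrite fineK // fin_numB ?fin_num_measure.
have q0 : 0 < q.
  rewrite -lte_fin qE -probability_setC //; apply: lt_le_trans eta_pos _.
  rewrite le_eqVlt; apply/orP; left; apply/eqP; congr (P _).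
  by apply/seteqP; split => w /=; rewrite lt0n => /eqP.
(* The factor 16 d collects [1/2] for staying alive, [1 / (4 * d)] for hitting and [1/2] from
   [1 - (1 - 1/L)^L]. *)
pose L := (Num.bound (16 * d%:R / q)).+1.
have Lq : 16 * d%:R / q <= L%:R.
  have /archi_boundP/ltW : 0 <= 16 * d%:R / q by rewrite divr_ge0 ?mulr_ge0 // ltW.
  by move=> /le_trans; apply; rewrite ler_nat.
have L0 : 0 < (L%:R : R) by rewrite ltr0n.
have [M HM] := @hitting_prob_parent R d (ltnW d_ge3) d_ge3 L.
have [p [K p01 [MK pK]]] := geometric_parameter R M.
have [p0 p1] := andP p01.
have FM := is_frog_model_configuration code_inj d0 regular mu p01.
set C := model_configuration _ _ _ _ in FM.
have e01 : 0 <= (L%:R : R)^-1 <= 1.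
  by rewrite invr_ge0 ltW //= invf_le1 // ler1n.
have occ_ge x : (q%:E <= unit_lebesgue [set w | (0 < occ (C w) x)%N])%E.
  by rewrite (probability_occ_gt0 FM) qE.
have alive_ge x i : ((1 / 2 : R)%:E <= unit_lebesgue [set w | alive M (life (C w) x i)])%E.
  by apply: le_trans (probability_alive_ge FM x i MK p0); rewrite lee_fin.
have fixpoint : (L%:R : R)^-1 <= q * (1 / 2) * (1 / (4 * d%:R)) * (1 - (1 - L%:R^-1) ^+ L).
  have H := @expr_one_minus_inv R L isT.
  apply: (@le_trans _ _ (q * (1 / 2) * (1 / (4 * d%:R)) * (1 / 2))); last first.
    apply: ler_wpM2l; last by lra.
    by rewrite !mulr_ge0 ?divr_ge0 // ?mulr_ge0 // ltW.
  have -> : q * (1 / 2) * (1 / (4 * d%:R)) * (1 / 2) = (16 * d%:R / q)^-1.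
    by field; rewrite !lt0r_neq0.
  by rewrite lef_pV2 // posrE divr_gt0 ?mulr_gt0.
have a0 : 0 <= (1 / 2 : R) by lra.
have reach_ge := probability_reaches_ge d_ge3 FM (ltW q0) a0 e01 occ_ge alive_ge HM fixpoint.
pose a := default_letter (ltnW d_ge3).
(* A child of the root, so that the first generation is started by the root, which is active at time
   0. *)
pose u : G := exist _ [:: a] isT.
have u0 : val u != [::] by [].
pose F n := reaches C L M n u.
have mF n : measurable (F n).
  exact: (sites_sigma_measurable FM (reaches_sigma d_ge3 L M n u0)).
have mcapF : measurable (\bigcap_n F n) by exact: bigcapT_measurable.
(* The events decrease with the generation, so continuity from above carries the uniform bound to
   their intersection. *)
have capF : ((L%:R^-1)%:E <= unit_lebesgue (\bigcap_n F n))%E.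
  have cF : (unit_lebesgue \o F) n @[n --> \oo] --> unit_lebesgue (\bigcap_n F n).
    apply: nonincreasing_cvg_mu => //.
      by rewrite ltey_eq fin_num_measure.
    apply/nonincreasing_seqP => n; apply/subsetPset; exact: reaches_decreasing.
  rewrite -(cvg_lim (@ereal_hausdorff R) cF).
  apply: lime_ge; first by apply/cvg_ex; eexists; exact: cF.
  by apply: nearW => n; exact: (reach_ge n u u0).
apply: le_lt_trans (_ : (p%:E < 1)%E); last by rewrite lte_fin.
apply: ereal_inf_lbound; exists p => //; split; first by rewrite p0 ltW.
exists _, _, unit_lebesgue, C; split; first exact: FM.
apply: (@lt_le_trans _ _ (L%:R^-1)%:E); first by rewrite lte_fin invr_gt0.
apply: le_trans capF _; apply: le_measure; rewrite ?inE //.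
  exact: measurable_survives code_inj (frog_measurable FM).
move=> w Fw /=.
apply: (@unbounded_activation_survives _ _ _ (fun x : G => size (val x))) => //.
- move=> x y /word_nbrs_size [] ->; last by [].
  exact: ltnW.
- by move=> x i n; exact: model_walk_step.
move=> N; have [||z Tz Nz] := @reaches_activation R _ _ d_ge3 _ _ C L M N.+1 u w u0.
- exact: (Fw N.+1 I).
- have -> : parent u = origin G by exact: val_inj.
  exact: le_lt_trans (activation_time_origin _) (ltry 0).
by exists z.
Qed.
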